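(* Let $c_0>0$, and let $\mathbf T,\mathbf n,\mathbf b:\mathbb R\to\mathbb R^3$ be the solution of $$\mathbf T'=c_0\,\mathbf n,\qquad \mathbf n'=c_0\,\mathbf T+\frac s2\,\mathbf b,\qquad \mathbf b'=-\frac s2\,\mathbf n,$$ with $\mathbf T(0)=(1,0,0)^T$, $\mathbf n(0)=(0,1,0)^T$, $\mathbf b(0)=(0,0,1)^T$. Write $\mathbf T=(T_1,T_2,T_3)^T$ and let $A_j=\lim_{s\to\infty}T_j(s)$ for $j=2,3$. Then $$A_2=\frac{2}{\pi c_0}\,e^{\pi c_0^2/4}\sinh\!\left(\frac{\pi c_0^2}{2}\right)\operatorname{Re}\{\Upsilon\},\qquad A_3=\frac{2}{\pi c_0}\,e^{\pi c_0^2/4}\sinh\!\left(\frac{\pi c_0^2}{2}\right)\operatorname{Im}\{\Upsilon\},$$ where $$\Upsilon=e^{i\pi/4}\,\Gamma\!\left(1-\frac{ic_0^2}{4}\right)\Gamma\!\left(\frac12+\frac{ic_0^2}{4}\right)=\frac{\sqrt\pi}{2}\,e^{i\pi/4}\,B\!\left(1-\frac{ic_0^2}{4},\frac12+\frac{ic_0^2}{4}\right).$$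
   Context: The system is the Frenet--Serret system in Minkowski 3-space (with form $-x_1^2+x_2^2+x_3^2$) for a time-like curve with curvature $\kappa=c_0$ and torsion $\tau=s/2$; $\mathbf T$ takes values in the hyperbolic plane $\{-x_1^2+x_2^2+x_3^2=-1,\ x_1>0\}$. $\Gamma$ is the Euler gamma function and $B(x,y)=\Gamma(x)\Gamma(y)/\Gamma(x+y)$ is the beta function. *)

(* Defs.v *)
From Stdlib Require Import Reals.
From Coquelicot Require Import Coquelicot.
Open Scope R_scope.

(* R^3, with the normed module structure over R of an iterated product. *)
Definition R3 : NormedModule R_AbsRing :=
  prod_NormedModule R_AbsRing
    (prod_NormedModule R_AbsRing R_NormedModule R_NormedModule) R_NormedModule.

Definition vec3 (x1 x2 x3 : R) : R3 := (x1, x2, x3).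
Definition coord2 (v : R3) : R := snd (fst v).
Definition coord3 (v : R3) : R := snd v.

Definition Cexp (z : C) : C :=
  (exp (Re z) * cos (Im z), exp (Re z) * sin (Im z)).

(* Principal power t^z of a positive real t. *)
Definition Cpower (t : R) (z : C) : C := Cexp (z * RtoC (ln t))%C.

(* Euler's integral of the second kind, improper at both ends.  It converges,
   and is the gamma function, for 0 < Re z; other arguments are not used. *)
Definition CGamma (z : C) : C :=
  RInt_gen (V := C_R_CompleteNormedModule)
    (fun t : R => (RtoC (exp (- t)) * Cpower t (z - 1))%C)
    (at_right 0) (Rbar_locally p_infty).

Definition CBeta (x y : C) : C := (CGamma x * CGamma y / CGamma (x + y))%C.

Definition Upsilon (c0 : R) : C :=
  (Cexp (Ci * RtoC (PI / 4)) *
   CGamma (1 - Ci * RtoC (c0 ^ 2 / 4)) *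
   CGamma (RtoC (1 / 2) + Ci * RtoC (c0 ^ 2 / 4)))%C.

(* Frenet-Serret equations of a time-like curve in Minkowski 3-space with
   curvature c0 and torsion s/2. *)
Definition frenet_system (c0 : R) (T n b : R -> R3) : Prop :=
  forall s : R,
    is_derive T s (scal c0 (n s)) /\
    is_derive n s (plus (scal c0 (T s)) (scal (s / 2) (b s))) /\
    is_derive b s (opp (scal (s / 2) (n s))).

(* Main.v *)
Require Import Defs.
From Stdlib Require Import Reals Lra Lia Psatz.
From Coquelicot Require Import Coquelicot.
Open Scope R_scope.

(** Put [al = c0^2/4] and [w = e^(i pi/4)].  The three coordinate triples
    [(T_j, n_j, b_j)] solve one and the same linear system, which preserves the
    form [- x^2 + y^2 + z^2]; so pairing a triple with any known solution of that
    system gives a first integral.  A known solution is built from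

      [I(s) = int_0^oo e^(- s conj(w) x - x^2) x^(2 i al) dx],
      [J(s) = I'(s) + (i s/2) I(s)],

    for which an integration by parts gives [J' = al I]: it is
    [(|J|^2 + al |I|^2, c0 Re (conj J I), c0 Im (conj J I))]
    ([scalar_frenet_invariant]).  As [s] grows, [I] tends to 0 and [|J|^2] to some
    [D > 0], so this solution tends to [(D, 0, 0)] and the pairing tends to
    [- D A_j]; its value at 0 is [c0] times the real or imaginary part of
    [conj (J 0) (I 0)] ([scalar_frenet_limit]).  At [s = 0] both integrals are
    gamma functions, and [conj (J 0) (I 0)] is [- Upsilon / 4] ([Upsilon_sol_W]).

    There remains [D].  For large [s] the Gaussian factor is negligible, and
    rotating the half-line in what is left gives
    [D = e^(- pi al) |Gamma(1 + 2 i al)|^2 / 4] ([is_lim_sol_J]).  The modulus of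
    the gamma function comes from the same functions: [|J|^2 - al |I|^2] is
    constant, and comparing [s = 0] with [s = oo] yields

      [|Gamma(1 + i al)|^2 - al |Gamma(1/2 + i al)|^2
         = e^(- pi al) |Gamma(1 + 2 i al)|^2]

    for every real [al] ([gamma_sq_relation]).  The moduli are even in [al], so
    the relations for [al] and [- al] together give
    [|Gamma(1 + i al)|^2 = cosh (pi al) |Gamma(1 + 2 i al)|^2].  Hence
    [|Gamma(1 + i al)|^2 sinh (pi al)] doubles when [al] does; being
    [pi al + O(al^2)] near 0, it equals [pi al] ([gamma_sq_1_reflection]).  The
    other combination of the two relations, at [al -> 0], gives
    [Gamma(1/2) = sqrt pi], which is what the beta form of [Upsilon] needs.

    All integrals are moved from the half-line to the line by [x = e^t]; there
    the integrands are smooth and decay exponentially at both ends. *)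

(** * Improper integrals over the line *)

Notation is_int_line f l :=
  (is_RInt_gen f (Rbar_locally m_infty) (Rbar_locally p_infty) l).

Notation is_Cint_line f l :=
  (is_RInt_gen (V := C_R_NormedModule) f (Rbar_locally m_infty) (Rbar_locally p_infty) l).

Lemma is_RInt_gen_antiderivative {V : CompleteNormedModule R_AbsRing}
  (Fa Fb : (R -> Prop) -> Prop) {FFa : Filter Fa} {FFb : Filter Fb}
  (F f : R -> V) (la lb : V) :
  (forall t, is_derive F t (f t)) -> (forall t, continuous f t) ->
  filterlim F Fa (locally la) -> filterlim F Fb (locally lb) ->
  is_RInt_gen f Fa Fb (minus lb la).
Proof.
  intros HF Hf Ha Hb P HP.
  assert (H : filterlim (fun ab : R * R => minus (F (snd ab)) (F (fst ab)))
                (filter_prod Fa Fb) (locally (minus lb la))).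
  { unfold minus.
    apply (filterlim_comp_2 (G := locally lb) (H := locally (opp la))
             (fun ab : R * R => F (snd ab)) (fun ab : R * R => opp (F (fst ab)))).
    - exact (filterlim_comp _ _ _ snd F _ _ _ filterlim_snd Hb).
    - refine (filterlim_comp _ _ _ (fun ab : R * R => F (fst ab)) opp _ (locally la) _ _ _).
      + exact (filterlim_comp _ _ _ fst F _ _ _ filterlim_fst Ha).
      + exact (filterlim_opp la).
    - exact (filterlim_plus lb (opp la)). }
  specialize (H P HP). unfold filtermap in H. unfold filtermapi.
  revert H. apply filter_imp. intros [a b] HP'. exists (minus (F b) (F a)).
  split; [|exact HP'].
  apply (is_RInt_derive F f); intros; auto.
Qed.

(** The logistic density: comparable to [e^(- |t|)], but smooth and with an
    elementary antiderivative. *)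
Definition bell (t : R) : R := exp t / (1 + exp t) ^ 2.

Lemma bell_antiderivative t : is_derive (fun t => - / (1 + exp t)) t (bell t).
Proof.
  unfold bell. auto_derive; pose proof (exp_pos t); [lra|]. field; lra.
Qed.

Lemma continuous_bell t : continuous bell t.
Proof.
  apply (ex_derive_continuous bell). unfold bell. auto_derive.
  pose proof (exp_pos t). nra.
Qed.

Lemma is_lim_bell_antiderivative :
  is_lim (fun t => - / (1 + exp t)) p_infty 0 /\
  is_lim (fun t => - / (1 + exp t)) m_infty (-1).
Proof.
  split.
  - replace (Finite 0) with (Rbar_opp (Rbar_inv p_infty)) by (simpl; f_equal; lra).
    apply is_lim_opp, is_lim_inv; [|discriminate].
    apply (is_lim_plus _ _ _ 1 p_infty); [apply is_lim_const|apply is_lim_exp_p|reflexivity].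
  - replace (Finite (-1)) with (Rbar_opp (Rbar_inv 1)) by (simpl; f_equal; lra).
    apply is_lim_opp, is_lim_inv; [|intros H; injection H; lra].
    replace (Finite 1) with (Rbar_plus 1 0) by (simpl; f_equal; ring).
    apply (is_lim_plus _ _ _ 1 0); [apply is_lim_const|apply is_lim_exp_m|reflexivity].
Qed.

(** The primitive of [f] varies less than [M] times the primitive of [bell],
    which has limits at both ends, hence it is Cauchy at both ends.  The total
    mass of [bell] is 1, whence the bound. *)
Lemma int_line_dominated {V : CompleteNormedModule R_AbsRing} (f : R -> V) (M : R) :
  (forall t, continuous f t) -> (forall t, norm (f t) <= M * bell t) ->
  exists l, is_int_line f l /\ norm l <= M.
Proof.
  intros Hc Hd.
  set (G := fun t => M * - / (1 + exp t)).
  assert (HG : forall t, is_derive G t (M * bell t)).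
  { intros t. apply (is_derive_scal (fun t => - / (1 + exp t))), bell_antiderivative. }
  assert (HGc : forall t, continuous (fun t => M * bell t) t).
  { intros t. apply (continuous_scal_r M bell), continuous_bell. }
  assert (HM : 0 <= M).
  { pose proof (Rle_trans _ _ _ (norm_ge_0 (f 0)) (Hd 0)) as H.
    unfold bell in H. rewrite exp_0 in H. lra. }
  assert (Gp : filterlim G (Rbar_locally p_infty) (locally 0)).
  { replace 0 with (M * 0) by ring.
    apply (is_lim_scal_l _ M p_infty 0), is_lim_bell_antiderivative. }
  assert (Gm : filterlim G (Rbar_locally m_infty) (locally (- M))).
  { replace (- M) with (M * -1) by ring.
    apply (is_lim_scal_l _ M m_infty (-1)), is_lim_bell_antiderivative. }
  assert (Hex : forall a b, ex_RInt f a b).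
  { intros a b. apply ex_RInt_continuous. auto. }
  set (F := fun t => RInt f 0 t).
  assert (HF : forall t, is_derive F t (f t)).
  { intros t. apply (is_derive_RInt f F 0 t); [|apply Hc].
    apply filter_forall. intros x. apply RInt_correct, Hex. }
  assert (HFG : forall u v, norm (minus (F v) (F u)) <= Rabs (G v - G u)).
  { assert (H : forall u v, u <= v -> norm (minus (F v) (F u)) <= Rabs (G v - G u)).
    { intros u v Huv. eapply Rle_trans; [|apply Rle_abs].
      apply (norm_RInt_le f (fun t => M * bell t) u v).
      - exact Huv.
      - auto.
      - apply (is_RInt_derive F f); auto.
      - apply (is_RInt_derive G); auto. }
    intros u v. destruct (Rle_dec u v) as [Huv|Huv]; [auto|].
    rewrite <- norm_opp, opp_minus, Rabs_minus_sym. apply H. lra. }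
  assert (Hlim : forall (A : (R -> Prop) -> Prop) (g : R), ProperFilter A ->
            filterlim G A (locally g) -> exists l, filterlim F A (locally l)).
  { intros A g PA Hg. apply (filterlim_locally_cauchy F). intros eps.
    destruct (proj2 (filterlim_locally_cauchy G) (ex_intro _ g Hg) eps) as [P [HP HPe]].
    exists P. split; [exact HP|]. intros u v Hu Hv. refine (norm_compat1 (V := V) (F u) (F v) eps _).
    eapply Rle_lt_trans; [apply HFG|]. apply HPe; auto. }
  destruct (Hlim _ _ _ Gp) as [lb Hb]. destruct (Hlim _ _ _ Gm) as [la Ha].
  exists (minus lb la).
  assert (H : is_int_line f (minus lb la)) by (apply (is_RInt_gen_antiderivative _ _ F); auto).
  split; [exact H|].
  apply (RInt_gen_norm (Fa := Rbar_locally m_infty) (Fb := Rbar_locally p_infty)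
           f (fun t => M * bell t)).
  - exists (fun x => x < 0) (fun x => 0 < x); [now exists 0|now exists 0|].
    simpl; intros; lra.
  - apply filter_forall. auto.
  - exact H.
  - pose proof (is_RInt_gen_antiderivative (V := R_CompleteNormedModule)
      _ _ G _ _ _ HG HGc Gm Gp) as HI.
    eapply eq_ind; [exact HI|]. unfold minus, plus, opp; simpl; ring.
Qed.

(** * Linear images and complex exponentials *)

(** Linear maps commute with Riemann sums.  This is used for real and imaginary
    parts, conjugation and multiplication by a complex constant. *)
Lemma is_RInt_linear {U V : NormedModule R_AbsRing} (A : U -> V) (HA : is_linear A)
  (f : R -> U) (a b : R) (l : U) :
  is_RInt f a b l -> is_RInt (fun t => A (f t)) a b (A l).
Proof.
  unfold is_RInt. intros H.
  apply filterlim_ext with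
    (fun ptd => A (scal (sign (b - a)) (Riemann_sum f ptd))).
  - intros ptd. rewrite (linear_scal A HA). f_equal.
    apply (SF_cons_ind (T := R) (fun p => A (Riemann_sum f p) =
             Riemann_sum (fun t => A (f t)) p)).
    + intros x. unfold Riemann_sum; simpl. apply (linear_zero A HA).
    + intros h s IH. rewrite !Riemann_sum_cons, (linear_plus A HA), (linear_scal A HA), IH.
      reflexivity.
  - eapply filterlim_comp; [exact H|]. apply (linear_cont A l HA).
Qed.

Lemma is_RInt_gen_linear {U V : NormedModule R_AbsRing} (A : U -> V) (HA : is_linear A)
  (Fa Fb : (R -> Prop) -> Prop) {FFa : Filter Fa} {FFb : Filter Fb} (f : R -> U) (l : U) :
  is_RInt_gen f Fa Fb l -> is_RInt_gen (fun t => A (f t)) Fa Fb (A l).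
Proof.
  intros H P HP.
  specialize (H (fun y => P (A y)) (linear_cont A l HA P HP)).
  revert H. unfold filtermapi. apply filter_imp. intros ab [y [Hy HPy]].
  exists (A y). split; [apply is_RInt_linear; assumption|exact HPy].
Qed.

Lemma is_int_line_linear {U V : NormedModule R_AbsRing} (A : U -> V) (HA : is_linear A)
  (f : R -> U) (l : U) : is_int_line f l -> is_int_line (fun t => A (f t)) (A l).
Proof. apply is_RInt_gen_linear; [exact HA|typeclasses eauto|typeclasses eauto]. Qed.

Lemma is_derive_linear {U V : NormedModule R_AbsRing} (A : U -> V) (HA : is_linear A)
  (f : R -> U) (x : R) (l : U) :
  is_derive f x l -> is_derive (fun t => A (f t)) x (A l).
Proof.
  intros H. unfold is_derive.
  eapply filterdiff_ext_lin.
  - apply (filterdiff_comp' f A x (fun y => scal y l) A); [exact H|].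
    apply filterdiff_linear, HA.
  - intros y. apply (linear_scal A HA).
Qed.

Lemma norm_C (z : C) : norm (V := C_R_NormedModule) z = Cmod z.
Proof.
  unfold norm, Cmod; simpl. unfold prod_norm, norm; simpl. unfold abs; simpl.
  pose proof (pow2_abs (fst z)) as H1. pose proof (pow2_abs (snd z)) as H2.
  simpl in H1, H2. rewrite H1, H2. reflexivity.
Qed.

Lemma is_linear_Cmult (c : C) :
  is_linear (U := C_R_NormedModule) (V := C_R_NormedModule) (Cmult c).
Proof.
  split.
  - intros x y. exact (Cmult_plus_distr_l c x y).
  - intros k x. destruct x, c.
    apply injective_projections; unfold scal; simpl; unfold prod_scal, scal; simpl;
      unfold mult; simpl; ring.
  - exists (Cmod c + 1). pose proof (Cmod_ge_0 c). split; [lra|].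
    intros x. rewrite !norm_C, Cmod_mult. pose proof (Cmod_ge_0 x). nra.
Qed.

Lemma is_linear_Re : is_linear (U := C_R_NormedModule) (V := R_NormedModule) Re.
Proof. exact is_linear_fst. Qed.

Lemma is_linear_Im : is_linear (U := C_R_NormedModule) (V := R_NormedModule) Im.
Proof. exact is_linear_snd. Qed.

Lemma is_linear_Cconj :
  is_linear (U := C_R_NormedModule) (V := C_R_NormedModule) Cconj.
Proof.
  split.
  - intros x y. apply injective_projections; simpl; unfold plus; simpl; ring.
  - intros k x.  apply injective_projections; unfold scal; simpl; unfold prod_scal, scal; simpl;
      unfold mult; simpl; ring.
  - exists 1. split; [lra|]. intros x. rewrite !norm_C.
    unfold Cmod, Cconj; simpl. apply Req_le. rewrite Rmult_1_l. f_equal. ring.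
Qed.

Lemma is_derive_pair (f g : R -> R) (x df dg : R) :
  is_derive f x df -> is_derive g x dg ->
  is_derive (V := C_R_NormedModule) (fun t => (f t, g t)) x (df, dg).
Proof.
  intros Hf Hg.
  pose proof (is_derive_plus _ _ _ _ _
    (is_derive_scal_l (V := C_R_NormedModule) f x df (1, 0) Hf)
    (is_derive_scal_l (V := C_R_NormedModule) g x dg (0, 1) Hg)) as H.
  eapply is_derive_ext with (2 := eq_ind _ (is_derive _ x) H _ _).
  - intros t. apply injective_projections; unfold plus, scal; simpl;
      unfold plus, scal; simpl; unfold mult; simpl; ring.
  Unshelve.
   apply injective_projections; unfold plus, scal; simpl;
      unfold plus, scal; simpl; unfold mult; simpl; ring.
Qed.

Lemma Cexp_add (z w : C) : Cexp (z + w) = (Cexp z * Cexp w)%C.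
Proof.
  destruct z as [a b], w as [c d]. unfold Cexp. simpl.
  rewrite exp_plus, cos_plus, sin_plus.
  apply injective_projections; simpl; ring.
Qed.

Lemma Cmod_Cexp (z : C) : Cmod (Cexp z) = exp (Re z).
Proof.
  unfold Cmod, Cexp; simpl.
  pose proof (sin2_cos2 (Im z)) as H. unfold Rsqr in H.
  etransitivity; [|apply (sqrt_Rsqr (exp (Re z))); left; apply exp_pos].
  f_equal. unfold Rsqr.
  transitivity (exp (Re z) * exp (Re z) * (sin (Im z) * sin (Im z) + cos (Im z) * cos (Im z))).
  - ring.
  - rewrite H. ring.
Qed.

Lemma is_derive_RtoC_mult (z : C) (t : R) :
  is_derive (V := C_R_NormedModule) (fun t => RtoC t * z)%C t z.
Proof.
  eapply is_derive_ext; [intros s; apply Cmult_comm|].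
  assert (H : is_derive (V := C_R_NormedModule) (fun t => z * (t, 0))%C t (z * (1, 0))%C).
  { apply (is_derive_linear (V := C_R_NormedModule) (Cmult z) (is_linear_Cmult z)).
    apply (is_derive_pair (fun t => t) (fun _ => 0)).
    - apply (is_derive_id (K := R_AbsRing)).
    - apply (is_derive_const (K := R_AbsRing) (V := R_NormedModule) 0). }
  change (1, 0) with (RtoC 1) in H. rewrite Cmult_1_r in H. exact H.
Qed.

Lemma is_derive_Cexp_line (z : C) (t : R) :
  is_derive (V := C_R_NormedModule) (fun t => Cexp (RtoC t * z)) t (z * Cexp (RtoC t * z))%C.
Proof.
  destruct z as [x y].
  replace ((x, y) * Cexp (RtoC t * (x, y)))%C with
    (x * exp (t * x) * cos (t * y) - y * exp (t * x) * sin (t * y),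
     x * exp (t * x) * sin (t * y) + y * exp (t * x) * cos (t * y)).
  - apply is_derive_ext with
      (f := fun t => (exp (t * x) * cos (t * y), exp (t * x) * sin (t * y))).
    + intros s. unfold Cexp; simpl. f_equal; f_equal; f_equal; ring.
    + apply is_derive_pair; auto_derive; trivial; ring.
  - unfold Cexp; simpl.
    replace (t * x - 0 * y) with (t * x) by ring.
    replace (t * y + 0 * x) with (t * y) by ring.
    apply injective_projections; simpl; ring.
Qed.

Lemma is_int_C_bound (f : R -> C) (v : C) (M : R) :
  (forall t, 0 <= t <= 1 -> Cmod (f t) <= M) ->
  is_RInt (V := C_R_NormedModule) f 0 1 v -> Cmod v <= M.
Proof.
  intros Hf Hv. rewrite <- norm_C. replace M with ((1 - 0) * M) by ring.
  apply (norm_RInt_le_const f 0 1); [lra| |exact Hv].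
  intros t Ht. rewrite norm_C. auto.
Qed.

Lemma Cmod_RtoC_mult_le (t : R) (z : C) : 0 <= t <= 1 -> Cmod (RtoC t * z) <= Cmod z.
Proof.
  intros Ht. rewrite Cmod_mult, Cmod_R, Rabs_pos_eq by lra.
  pose proof (Cmod_ge_0 z). nra.
Qed.

Lemma Re_le_Cmod (z : C) : Re z <= Cmod z.
Proof. eapply Rle_trans; [apply Rle_abs|]. apply re_le_Cmod. Qed.

Lemma Cexp_0 : Cexp 0 = 1.
Proof. unfold Cexp; simpl. rewrite exp_0, cos_0, sin_0. apply injective_projections; simpl; ring. Qed.

Lemma Cexp_line_bound (z : C) (t : R) : 0 <= t <= 1 -> Cmod (Cexp (RtoC t * z)) <= exp (Cmod z).
Proof.
  intros Ht. rewrite Cmod_Cexp.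
  pose proof (Re_le_Cmod (RtoC t * z)). pose proof (Cmod_RtoC_mult_le t z Ht).
  destruct (Req_dec (Re (RtoC t * z)) (Cmod z)) as [->|]; [lra|left; apply exp_increasing; lra].
Qed.

Lemma continuous_Cexp_line (z c d : C) (t : R) :
  continuous (U := C_R_NormedModule) (fun t => c * (Cexp (RtoC t * z) - d))%C t.
Proof.
  apply (ex_derive_continuous (V := C_R_NormedModule)).
  eexists. apply (is_derive_linear (V := C_R_NormedModule) (Cmult c) (is_linear_Cmult c)).
  apply (is_derive_minus (V := C_R_NormedModule) _ (fun _ => d)).
  - apply is_derive_Cexp_line.
  - apply (is_derive_const (K := R_AbsRing) (V := C_R_NormedModule) d).
Qed.

(** [e^z - 1] is the integral of [z e^(t z)] over [0 <= t <= 1]. *)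
Lemma Cexp_sub_1_bound (z : C) (M : R) :
  (forall t, 0 <= t <= 1 -> Cmod (Cexp (RtoC t * z)) <= M) ->
  Cmod (Cexp z - 1) <= Cmod z * M.
Proof.
  intros HM. apply (is_int_C_bound (fun t => z * Cexp (RtoC t * z))%C).
  - intros t Ht. rewrite Cmod_mult. apply Rmult_le_compat_l; [apply Cmod_ge_0|].
    apply HM, Ht.
  - replace (Cexp z - 1)%C with (minus (G := C_R_NormedModule) (Cexp (1 * z)) (Cexp (0 * z))).
    + apply (is_RInt_derive (V := C_R_CompleteNormedModule) (fun t => Cexp (RtoC t * z))).
      * intros. apply is_derive_Cexp_line.
      * intros. eapply continuous_ext; [|apply (continuous_Cexp_line z z 0)].
        intros s. change (z * (Cexp (RtoC s * z) - 0) = z * Cexp (RtoC s * z))%C. ring.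
    + rewrite Cmult_1_l, Cmult_0_l, Cexp_0. reflexivity.
Qed.

Lemma Cexp_taylor1 (z : C) : Cmod (Cexp z - 1) <= Cmod z * exp (Cmod z).
Proof. apply Cexp_sub_1_bound. intros t Ht. apply Cexp_line_bound, Ht. Qed.

Lemma Cexp_imaginary_sub_1 (y : R) : Cmod (Cexp (0, y) - 1) <= Rabs y.
Proof.
  replace (Rabs y) with (Cmod (0, y) * 1).
  - apply Cexp_sub_1_bound. intros t _. rewrite Cmod_Cexp. simpl.
    rewrite !Rmult_0_r, Rmult_0_l, Rminus_0_r, exp_0. lra.
  - rewrite Rmult_1_r. unfold Cmod; simpl. rewrite <- sqrt_Rsqr_abs. f_equal. unfold Rsqr. ring.
Qed.

(** [e^z - 1 - z] is the integral of [z (e^(t z) - 1)] over [0 <= t <= 1]. *)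
Lemma Cexp_taylor2 (z : C) : Cmod (Cexp z - 1 - z) <= Cmod z ^ 2 * exp (Cmod z).
Proof.
  apply (is_int_C_bound (fun t => z * (Cexp (RtoC t * z) - 1))%C).
  - intros t Ht. rewrite Cmod_mult.
    replace (Cmod z ^ 2 * exp (Cmod z)) with (Cmod z * (Cmod z * exp (Cmod z))) by ring.
    apply Rmult_le_compat_l; [apply Cmod_ge_0|].
    eapply Rle_trans; [apply Cexp_taylor1|].
    pose proof (Cmod_RtoC_mult_le t z Ht).
    apply Rmult_le_compat; [apply Cmod_ge_0|left; apply exp_pos|lra|].
    destruct (Req_dec (Cmod (RtoC t * z)) (Cmod z)) as [->|]; [lra|left; apply exp_increasing; lra].
  - replace (Cexp z - 1 - z)%C with
      (minus (G := C_R_NormedModule) (Cexp (1 * z) - 1 * z)%C (Cexp (0 * z) - 0 * z)%C).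
    + apply (is_RInt_derive (V := C_R_CompleteNormedModule)
               (fun t => Cexp (RtoC t * z) - RtoC t * z)%C).
      * intros t _.
        replace (z * (Cexp (RtoC t * z) - 1))%C with
          (minus (G := C_R_NormedModule) (z * Cexp (RtoC t * z))%C z)
          by (change (z * Cexp (RtoC t * z) - z = z * (Cexp (RtoC t * z) - 1))%C; ring).
        apply (is_derive_minus (V := C_R_NormedModule)); [apply is_derive_Cexp_line|].
        apply (is_derive_RtoC_mult z).
      * intros. apply continuous_Cexp_line.
    + rewrite !Cmult_1_l, !Cmult_0_l, Cexp_0. change (Cexp z - z - (1 - 0) = Cexp z - 1 - z)%C. ring.
Qed.

(** * The family of exponential integrals *)

(** With [x = e^t] this is [x^(k + i g) e^(- l x - e x^2)].  Since [dt = dx / x],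
    [Phi k g e l] is the integral of [x^(k - 1 + i g) e^(- l x - e x^2)] over the
    half-line: a value of the gamma function for [l = 1, e = 0], half a value for
    [l = 0, e = 1], and a parabolic cylinder function of [l], up to an elementary
    factor, when [e = 1]. *)
Definition kernel (k g e : R) (l : C) (t : R) : C :=
  Cexp (k * t - Re l * exp t - e * exp t ^ 2, g * t - Im l * exp t).

Definition Phi (k g e : R) (l : C) : C :=
  RInt_gen (V := C_R_CompleteNormedModule) (kernel k g e l)
    (Rbar_locally m_infty) (Rbar_locally p_infty).

(** The condition on the exponent under which [Phi] converges.  It covers both
    [e = 0 < l1] and [e = 1] with any [l1]. *)
Definition coercive (l1 e : R) : Prop :=
  exists d K, 0 < d /\ forall x, 0 < x -> d * x - K <= l1 * x + e * x ^ 2.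

Lemma Cmod_kernel k g e l t :
  Cmod (kernel k g e l t) = exp (k * t - Re l * exp t - e * exp t ^ 2).
Proof. apply Cmod_Cexp. Qed.

Lemma exp_le (x y : R) : x <= y -> exp x <= exp y.
Proof. intros [H| ->]; [left; apply exp_increasing, H|apply Rle_refl]. Qed.

Lemma exp_abs_le_bell (t : R) : exp (- Rabs t) <= 4 * bell t.
Proof.
  unfold bell. pose proof (exp_pos t) as Hx.
  apply Rmult_le_reg_r with ((1 + exp t) ^ 2); [nra|].
  replace (4 * (exp t / (1 + exp t) ^ 2) * (1 + exp t) ^ 2) with (4 * exp t)
    by (field; nra).
  destruct (Rle_dec 0 t) as [Ht|Ht].
  - rewrite Rabs_pos_eq, exp_Ropp by lra.
    assert (1 <= exp t) by (rewrite <- exp_0; apply exp_le; lra).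
    apply Rmult_le_reg_l with (exp t); [lra|].
    rewrite <- Rmult_assoc, Rinv_r, Rmult_1_l by lra. nra.
  - rewrite Rabs_left, Ropp_involutive by lra.
    assert (exp t <= 1) by (rewrite <- exp_0; apply exp_le; lra). nra.
Qed.

(** For [t <= 0] the factor [e^(k t)] decays since [k >= 1]; for [t >= 0] the term
    [- d e^t] beats [(k + 1) t], by the tangent line inequality for the
    exponential at the point [ln ((k + 1) / d)]. *)
Lemma kernel_dominated (k l1 e : R) : 1 <= k -> coercive l1 e ->
  exists M, forall t, exp (k * t - l1 * exp t - e * exp t ^ 2) <= M * bell t.
Proof.
  intros Hk (d & K & Hd & HK).
  set (A := (k + 1) / d).
  assert (HA : 0 < A) by (apply Rdiv_lt_0_compat; lra).
  set (B := Rabs K + (k + 1) * Rabs (ln A)).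
  exists (4 * exp B). intros t.
  apply Rle_trans with (exp B * exp (- Rabs t)).
  - rewrite <- exp_plus. apply exp_le. specialize (HK (exp t) (exp_pos t)).
    pose proof (Rabs_pos (ln A)). pose proof (Rle_abs K). pose proof (Rle_abs (ln A)).
    destruct (Rle_dec 0 t) as [Ht|Ht].
    + rewrite Rabs_pos_eq by lra.
      assert (H2 : (k + 1) * (1 + (t - ln A)) <= d * exp t).
      { replace (d * exp t) with ((k + 1) * exp (t - ln A)).
        - apply Rmult_le_compat_l; [lra|]. apply exp_ineq1_le.
        - unfold Rminus. rewrite exp_plus, exp_Ropp, exp_ln by assumption.
          unfold A. field. lra. }
      unfold B. nra.
    + rewrite Rabs_left by lra. pose proof (exp_pos t). unfold B. nra.
  - pose proof (exp_abs_le_bell t). pose proof (exp_pos B). nra.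
Qed.

Lemma is_derive_kernel k g e l t :
  is_derive (V := C_R_NormedModule) (kernel k g e l) t
    ((k, g) * kernel k g e l t - l * kernel (k + 1) g e l t
      - RtoC (2 * e) * kernel (k + 2) g e l t)%C.
Proof.
  destruct l as [l1 l2].
  unfold kernel, Cexp; simpl.
  replace ((k + 1) * t - l1 * exp t - e * (exp t * (exp t * 1)))
    with (t + (k * t - l1 * exp t - e * (exp t * (exp t * 1)))) by ring.
  replace ((k + 2) * t - l1 * exp t - e * (exp t * (exp t * 1)))
    with (t + (t + (k * t - l1 * exp t - e * (exp t * (exp t * 1))))) by ring.
  rewrite !exp_plus. set (E := exp (k * t - _ - _)).
  match goal with |- is_derive _ _ ?x => rewrite (surjective_pairing x) end.
  apply is_derive_pair; auto_derive; trivial; simpl; fold E;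
   change (exp (k * t + - (l1 * exp t) + - (e * (exp t * (exp t * 1))))) with E;
   unfold Rminus; ring.
Qed.

Lemma continuous_kernel k g e l t :
  continuous (U := C_R_NormedModule) (kernel k g e l) t.
Proof.
  apply (ex_derive_continuous (V := C_R_NormedModule)). eexists. apply is_derive_kernel.
Qed.

Lemma is_int_line_Phi k g e l : 1 <= k -> coercive (Re l) e ->
  is_Cint_line (kernel k g e l) (Phi k g e l).
Proof.
  intros Hk He. destruct (kernel_dominated k (Re l) e Hk He) as [M HM].
  apply (RInt_gen_correct (V := C_R_CompleteNormedModule)).
  destruct (int_line_dominated (V := C_R_CompleteNormedModule) (kernel k g e l) M)
    as [v [Hv _]].
  - apply continuous_kernel.
  - intros t. rewrite norm_C, Cmod_kernel. apply HM.
  - exists v. exact Hv.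
Qed.

Lemma is_int_line_unique (f : R -> C) (v w : C) :
  is_Cint_line f v ->
  is_Cint_line f w ->
  v = w.
Proof.
  intros Hv Hw.
  rewrite <- (is_RInt_gen_unique (V := C_R_CompleteNormedModule) f v Hv).
  apply (is_RInt_gen_unique (V := C_R_CompleteNormedModule) f w Hw).
Qed.

Lemma is_lim_bell :
  filterlim bell (Rbar_locally m_infty) (locally 0) /\
  filterlim bell (Rbar_locally p_infty) (locally 0).
Proof.
  assert (H0 : forall t, 0 <= bell t).
  { intros t. unfold bell. pose proof (exp_pos t).
    apply Rlt_le, Rdiv_lt_0_compat; nra. }
  split.
  - apply (is_lim_le_le_loc (fun _ => 0) exp bell m_infty 0).
    + exists 0. intros t _. split; [apply H0|]. unfold bell.
      pose proof (exp_pos t). apply Rmult_le_reg_r with ((1 + exp t) ^ 2); [nra|].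
      unfold Rdiv. rewrite Rmult_assoc, Rinv_l by nra. nra.
    + apply is_lim_const.
    + apply is_lim_exp_m.
  - apply (is_lim_le_le_loc (fun _ => 0) (fun t => / exp t) bell p_infty 0).
    + exists 0. intros t _. split; [apply H0|]. unfold bell.
      pose proof (exp_pos t). apply Rmult_le_reg_r with ((1 + exp t) ^ 2); [nra|].
      unfold Rdiv. rewrite Rmult_assoc, Rinv_l by nra.
      apply Rmult_le_reg_l with (exp t); [lra|].
      replace (exp t * (/ exp t * (1 + exp t) ^ 2)) with ((1 + exp t) ^ 2) by (field; lra).
      nra.
    + apply is_lim_const.
    + apply (is_lim_inv exp p_infty p_infty); [apply is_lim_exp_p|discriminate].
Qed.

Lemma kernel_vanishes k g e l (F : (R -> Prop) -> Prop) {FF : Filter F} :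
  1 <= k -> coercive (Re l) e -> filterlim bell F (locally 0) ->
  filterlim (kernel k g e l) F (locally (zero : C_R_NormedModule)).
Proof.
  intros Hk He HF. destruct (kernel_dominated k (Re l) e Hk He) as [M HM].
  apply (filterlim_norm_zero (V := C_R_NormedModule)).
  apply (filterlim_le_le (fun _ => 0) _ (fun t => M * bell t) 0).
  - apply filter_forall. intros t. rewrite norm_C. split; [apply Cmod_ge_0|].
    rewrite Cmod_kernel. apply HM.
  - apply filterlim_const.
  - simpl Rbar_locally. replace 0 with (M * 0) by ring.
    eapply filterlim_comp; [exact HF|].
    apply (filterlim_scal_r (K := R_AbsRing) (V := R_NormedModule) M 0).
Qed.

Lemma continuous_Cmult_l (c : C) (f : R -> C) (t : R) :
  continuous (U := C_R_NormedModule) f t ->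
  continuous (U := C_R_NormedModule) (fun t => c * f t)%C t.
Proof.
  intros H. apply (continuous_comp (V := C_R_NormedModule) (W := C_R_NormedModule) f (Cmult c) t H).
  apply (linear_cont (U := C_R_NormedModule) (V := C_R_NormedModule) (Cmult c)).
  apply is_linear_Cmult.
Qed.

(** The derivative of [kernel] has integral 0, because [kernel] vanishes at both
    ends.  For [l = 0, e = 1] or [l = 1, e = 0] this is the functional equation of
    the gamma function; in general it is the differential equation of [Phi]. *)
Lemma Phi_by_parts k g e l : 1 <= k -> coercive (Re l) e ->
  (l * Phi (k + 1) g e l + RtoC (2 * e) * Phi (k + 2) g e l = (k, g) * Phi k g e l)%C.
Proof.
  intros Hk He.
  assert (H0 : is_Cint_line (fun t => (k, g) * kernel k g e l t - l * kernel (k + 1) g e l t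
      - RtoC (2 * e) * kernel (k + 2) g e l t)%C (minus zero zero)).
  { apply (is_RInt_gen_antiderivative (V := C_R_CompleteNormedModule) _ _ (kernel k g e l)).
    - intros t. apply is_derive_kernel.
    - intros t. apply (continuous_minus (V := C_R_NormedModule));
        [apply (continuous_minus (V := C_R_NormedModule))|];
        apply continuous_Cmult_l, continuous_kernel.
    - apply (kernel_vanishes k g e l (Rbar_locally m_infty)); auto. apply is_lim_bell.
    - apply (kernel_vanishes k g e l (Rbar_locally p_infty)); auto. apply is_lim_bell. }
  pose proof (fun c j (Hj : 1 <= j) => is_int_line_linear (Cmult c) (is_linear_Cmult c)
    _ _ (is_int_line_Phi j g e l Hj He)) as HP.
  assert (H1 : is_Cint_line (fun t => (k, g) * kernel k g e l t - l * kernel (k + 1) g e l t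
      - RtoC (2 * e) * kernel (k + 2) g e l t)%C
    ((k, g) * Phi k g e l - l * Phi (k + 1) g e l
      - RtoC (2 * e) * Phi (k + 2) g e l)%C).
  { apply (is_RInt_gen_minus (V := C_R_NormedModule));
      [apply (is_RInt_gen_minus (V := C_R_NormedModule))|]; apply HP; lra. }
  rewrite minus_eq_zero in H0.
  pose proof (is_int_line_unique _ _ _ H0 H1) as H.
  change (RtoC 0 = ((k, g) * Phi k g e l - l * Phi (k + 1) g e l
      - RtoC (2 * e) * Phi (k + 2) g e l)%C) in H.
  replace ((k, g) * Phi k g e l)%C with
    ((k, g) * Phi k g e l - l * Phi (k + 1) g e l
      - RtoC (2 * e) * Phi (k + 2) g e l +
      (l * Phi (k + 1) g e l + RtoC (2 * e) * Phi (k + 2) g e l))%C by ring.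
  rewrite <- H. ring.
Qed.

Lemma coercive_perturb l1 e : coercive l1 e ->
  exists r, 0 < r /\ forall h, Rabs h <= r -> coercive (l1 + h) e.
Proof.
  intros (d & K & Hd & HK). exists (d / 2). split; [lra|].
  intros h Hh. exists (d / 2), K. split; [lra|]. intros x Hx.
  specialize (HK x Hx). apply Rabs_le_between in Hh. nra.
Qed.

Lemma kernel_shift k g e l w t :
  kernel k g e (l + w) t = (kernel k g e l t * Cexp (- (w * RtoC (exp t))))%C.
Proof.
  unfold kernel. rewrite <- Cexp_add. f_equal.
  destruct l, w. apply injective_projections; simpl; ring.
Qed.

Lemma kernel_succ k g e l t :
  kernel (k + 1) g e l t = (RtoC (exp t) * kernel k g e l t)%C.
Proof.
  unfold kernel. replace (RtoC (exp t)) with (Cexp (RtoC t)).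
  - rewrite <- Cexp_add. f_equal. destruct l. apply injective_projections; simpl; ring.
  - unfold Cexp; simpl. rewrite cos_0, sin_0. apply injective_projections; simpl; ring.
Qed.

(** The remainder is again bounded by a function of the shape of a kernel, with
    [k + 2] in place of [k]. *)
Lemma kernel_taylor k g e l w t :
  Cmod (kernel k g e (l + w) t - kernel k g e l t + w * kernel (k + 1) g e l t) <=
  Cmod w ^ 2 * exp ((k + 2) * t - (Re l - Cmod w) * exp t - e * exp t ^ 2).
Proof.
  rewrite kernel_shift, kernel_succ.
  set (z := (- (w * RtoC (exp t)))%C).
  replace (kernel k g e l t * Cexp z - kernel k g e l t + w * (RtoC (exp t) * kernel k g e l t))%C
    with (kernel k g e l t * (Cexp z - 1 - z))%C by (unfold z; ring).
  rewrite Cmod_mult, Cmod_kernel.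
  assert (Hz : Cmod z = Cmod w * exp t).
  { unfold z. rewrite Cmod_opp, Cmod_mult, Cmod_R, Rabs_pos_eq; [reflexivity|].
    left; apply exp_pos. }
  eapply Rle_trans; [apply Rmult_le_compat_l; [left; apply exp_pos|apply Cexp_taylor2]|].
  rewrite Hz. apply Req_le.
  replace ((k + 2) * t - (Re l - Cmod w) * exp t - e * exp t ^ 2) with
    (t + (t + ((k * t - Re l * exp t - e * exp t ^ 2) + Cmod w * exp t))) by ring.
  rewrite !exp_plus. ring.
Qed.

(** A quadratic bound on the remainder replaces any passage to the limit under
    the integral sign. *)
Lemma is_derive_quadratic (f : R -> C) (s r K : R) (d : C) : 0 < r ->
  (forall h, Rabs h <= r -> Cmod (f (s + h) - f s - RtoC h * d) <= K * h ^ 2) ->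
  is_derive (V := C_R_NormedModule) f s d.
Proof.
  intros Hr H. split; [apply is_linear_scal_l|].
  intros x Hx. apply (is_filter_lim_locally_unique s x) in Hx. subst x.
  intros eps.
  assert (HK : 0 < Rabs K + 1) by (pose proof (Rabs_pos K); lra).
  assert (Hd : 0 < Rmin r (eps / (Rabs K + 1))).
  { apply Rmin_pos; [exact Hr|]. apply Rdiv_lt_0_compat; [apply cond_pos|exact HK]. }
  exists (mkposreal _ Hd). intros y Hy.
  assert (Hy' : Rabs (y - s) < Rmin r (eps / (Rabs K + 1))) by exact Hy.
  pose proof (Rlt_le_trans _ _ _ Hy' (Rmin_l _ _)) as H1.
  pose proof (Rlt_le_trans _ _ _ Hy' (Rmin_r _ _)) as H2.
  rewrite norm_C.
  match goal with |- Cmod ?z <= _ =>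
    replace z with (f (s + (y - s))%R - f s - RtoC (y - s) * d)%C end.
  2:{ rewrite (Rplus_minus s y).
      rewrite <- scal_R_Cmult. reflexivity. }
  eapply Rle_trans; [apply H; lra|].
  change (norm (minus y s)) with (Rabs (y - s)).
  rewrite <- pow2_abs. pose proof (Rabs_pos (y - s)). pose proof (Rle_abs K).
  assert (Rabs (y - s) * (Rabs K + 1) <= eps).
  { apply Rlt_le in H2. apply (Rmult_le_compat_r (Rabs K + 1)) in H2; [|lra].
    unfold Rdiv in H2. rewrite Rmult_assoc, Rinv_l in H2; lra. }
  nra.
Qed.

(** The second-order remainder of the integrand is dominated uniformly, so it
    integrates to a remainder of the same order. *)
Lemma is_derive_Phi k g e (l m : C) (s : R) :
  1 <= k -> coercive (Re (l + RtoC s * m)) e ->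
  is_derive (V := C_R_NormedModule) (fun s => Phi k g e (l + RtoC s * m)) s
    (- (m * Phi (k + 1) g e (l + RtoC s * m)))%C.
Proof.
  intros Hk He. set (l0 := (l + RtoC s * m)%C) in *.
  destruct (coercive_perturb _ _ He) as [r [Hr Hcr]].
  destruct (kernel_dominated (k + 2) (Re l0 - r) e) as [M HM]; [lra| |].
  { apply (Hcr (- r)). rewrite Rabs_Ropp, Rabs_pos_eq; lra. }
  pose proof (Cmod_ge_0 m) as Hm.
  (* The denominator Cmod m + 1 allows m = 0. *)
  apply is_derive_quadratic with (r := r / (Cmod m + 1)) (K := Cmod m ^ 2 * M).
  { apply Rdiv_lt_0_compat; lra. }
  intros h Hh. fold l0.
  replace (l + RtoC (s + h) * m)%C with (l0 + RtoC h * m)%C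
    by (unfold l0; rewrite RtoC_plus; ring).
  set (w := (RtoC h * m)%C).
  assert (Hw : Cmod w = Rabs h * Cmod m) by (unfold w; rewrite Cmod_mult, Cmod_R; reflexivity).
  assert (Hwr : Cmod w <= r).
  { rewrite Hw. apply (Rmult_le_compat_r (Cmod m + 1)) in Hh; [|lra].
    unfold Rdiv in Hh. rewrite Rmult_assoc, Rinv_l in Hh by lra.
    pose proof (Rabs_pos h). nra. }
  assert (Hcw : coercive (Re (l0 + w)) e).
  { apply (Hcr (Re w)). eapply Rle_trans; [apply re_le_Cmod|exact Hwr]. }
  destruct (int_line_dominated (V := C_R_CompleteNormedModule)
    (fun t => kernel k g e (l0 + w) t - kernel k g e l0 t + w * kernel (k + 1) g e l0 t)%C
    (Cmod w ^ 2 * M)) as [v [Hv Hvn]].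
  - intros t. apply (continuous_plus (V := C_R_NormedModule));
      [apply (continuous_minus (V := C_R_NormedModule))|];
      try apply continuous_Cmult_l; apply continuous_kernel.
  - intros t. rewrite norm_C. eapply Rle_trans; [apply kernel_taylor|].
    rewrite Rmult_assoc. apply Rmult_le_compat_l; [apply pow2_ge_0|].
    eapply Rle_trans; [|apply HM]. apply exp_le. pose proof (exp_pos t). nra.
  - assert (Hv' : is_Cint_line
      (fun t => kernel k g e (l0 + w) t - kernel k g e l0 t
        + w * kernel (k + 1) g e l0 t)%C
      (Phi k g e (l0 + w) - Phi k g e l0 + w * Phi (k + 1) g e l0)%C).
    { apply (is_RInt_gen_plus (V := C_R_NormedModule));
        [apply (is_RInt_gen_minus (V := C_R_NormedModule))|
         apply (is_int_line_linear (Cmult w) (is_linear_Cmult w))];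
        apply is_int_line_Phi; auto; lra. }
    pose proof (is_int_line_unique _ _ _ Hv Hv') as E. subst v.
    rewrite norm_C in Hvn.
    replace (Phi k g e (l0 + w) - Phi k g e l0 - RtoC h * - (m * Phi (k + 1) g e l0))%C
      with (Phi k g e (l0 + w) - Phi k g e l0 + w * Phi (k + 1) g e l0)%C
      by (unfold w; ring).
    eapply Rle_trans; [exact Hvn|]. rewrite Hw, <- (pow2_abs h). apply Req_le. ring.
Qed.

(** * The gamma function as such an integral *)

(** The substitution [x = e^(m t)] sends the ends of the half-line to the ends of
    the line. *)
Lemma is_RInt_gen_exp_subst {V : CompleteNormedModule R_AbsRing} (m : R) (f : R -> V) (v : V) :
  0 < m -> (forall x, 0 < x -> continuous f x) ->
  is_int_line (fun t => scal (m * exp (m * t)) (f (exp (m * t)))) v ->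
  is_RInt_gen f (at_right 0) (Rbar_locally p_infty) v.
Proof.
  intros Hm Hf H P HP. specialize (H P HP).
  destruct H as [Q1 Q2 [M1 HM1] [M2 HM2] HQ].
  apply (Filter_prod _ _ _ (fun x => 0 < x /\ Q1 (ln x / m)) (fun x => 0 < x /\ Q2 (ln x / m))).
  - exists (mkposreal _ (exp_pos (m * M1))). intros x Hx Hx0.
    split; [exact Hx0|]. apply HM1.
    assert (Hx' : Rabs (x - 0) < exp (m * M1)) by exact Hx.
    rewrite Rminus_0_r, Rabs_pos_eq in Hx' by lra.
    apply ln_increasing in Hx'; [|exact Hx0]. rewrite ln_exp in Hx'.
    apply Rmult_lt_reg_r with m; [exact Hm|].
    unfold Rdiv. rewrite Rmult_assoc, Rinv_l by lra. lra.
  - exists (exp (m * M2)). intros x Hx. pose proof (exp_pos (m * M2)).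
    split; [lra|]. apply HM2.
    apply ln_increasing in Hx; [|assumption]. rewrite ln_exp in Hx.
    apply Rmult_lt_reg_r with m; [exact Hm|].
    unfold Rdiv. rewrite Rmult_assoc, Rinv_l by lra. lra.
  - intros x y [Hx Hx1] [Hy Hy1]. destruct (HQ _ _ Hx1 Hy1) as [w [Hw Pw]].
    exists w. split; [|exact Pw]. simpl in *.
    assert (Hxy : forall z, 0 < z -> exp (m * (ln z / m)) = z).
    { intros z Hz. replace (m * (ln z / m)) with (ln z) by (field; lra). apply exp_ln, Hz. }
    assert (HC1 : forall t, Rmin (ln x / m) (ln y / m) <= t <= Rmax (ln x / m) (ln y / m) ->
      continuous f (exp (m * t))) by (intros; apply Hf, exp_pos).
    assert (HC2 : forall t, Rmin (ln x / m) (ln y / m) <= t <= Rmax (ln x / m) (ln y / m) ->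
      is_derive (fun t => exp (m * t)) t (m * exp (m * t)) /\
      continuous (fun t => m * exp (m * t)) t).
    { intros t _. split.
      - auto_derive; trivial. ring.
      - apply (ex_derive_continuous (fun t => m * exp (m * t))). auto_derive; trivial. }
    pose proof (is_RInt_comp f (fun t => exp (m * t)) (fun t => m * exp (m * t))
      (ln x / m) (ln y / m)) as HC.
    cbv beta in HC. rewrite (Hxy x Hx), (Hxy y Hy) in HC.
    rewrite <- (is_RInt_unique _ _ _ _ Hw), (is_RInt_unique _ _ _ _ (HC HC1 HC2)).
    apply (RInt_correct (V := V)), (ex_RInt_continuous (V := V)).
    intros z Hz. apply Hf. revert Hz. unfold Rmin. destruct Rle_dec; lra.
Qed.

Lemma CGamma_exp_subst (m : R) (z v : C) : 0 < m ->
  is_Cint_line (fun t => RtoC m * Cexp (RtoC (m * t) * z - RtoC (exp (m * t))))%C v ->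
  CGamma z = v.
Proof.
  intros Hm Hv. unfold CGamma. apply (is_RInt_gen_unique (V := C_R_CompleteNormedModule)).
  apply (is_RInt_gen_exp_subst (V := C_R_CompleteNormedModule) m); [exact Hm| |].
  - intros x Hx. apply (ex_derive_continuous (V := C_R_NormedModule)).
    destruct z as [z1 z2]. unfold Cpower, Cexp. simpl.
    eexists. apply is_derive_ext with (f := fun t =>
      (exp (- t) * (exp ((z1 - 1) * ln t) * cos (z2 * ln t)),
       exp (- t) * (exp ((z1 - 1) * ln t) * sin (z2 * ln t)))).
    { intros t.
      replace ((z1 + - (1)) * ln t - (z2 + - 0) * 0) with ((z1 - 1) * ln t) by ring.
      replace ((z1 + - (1)) * 0 + (z2 + - 0) * ln t) with (z2 * ln t) by ring.
      apply injective_projections; simpl; ring. }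
    apply is_derive_pair; apply Derive_correct; auto_derive; auto.
  - revert Hv. apply is_RInt_gen_ext. apply filter_forall. intros [x y] t _.
    unfold Cpower. rewrite ln_exp, scal_R_Cmult.
    replace (RtoC (exp (- exp (m * t)))) with (Cexp (- RtoC (exp (m * t)))).
    + replace (RtoC (m * exp (m * t))) with (RtoC m * Cexp (RtoC (m * t)))%C.
      * rewrite <- Cmult_assoc, <- !Cexp_add. do 2 f_equal. ring.
      * unfold Cexp; simpl.
        rewrite cos_0, sin_0. apply injective_projections; simpl; ring.
    + unfold Cexp; simpl. rewrite Ropp_0, cos_0, sin_0. apply injective_projections; simpl; ring.
Qed.

Lemma coercive_lin (l1 : R) : 0 < l1 -> coercive l1 0.
Proof. intros H. exists l1, 0. split; [exact H|]. intros; lra. Qed.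

Lemma coercive_quad (l1 : R) : coercive l1 1.
Proof.
  exists 1, ((1 - l1) ^ 2 / 4). split; [lra|]. intros x _.
  pose proof (pow2_ge_0 (x - (1 - l1) / 2)). nra.
Qed.

Lemma CGamma_Phi_lin (z : C) : 1 <= Re z -> CGamma z = Phi (Re z) (Im z) 0 1.
Proof.
  intros Hz. apply (CGamma_exp_subst 1); [lra|].
  eapply is_RInt_gen_ext; [|apply is_int_line_Phi; [exact Hz|apply coercive_lin; simpl; lra]].
  apply filter_forall. intros [x y] t _. unfold kernel.
  rewrite Cmult_1_l, (Rmult_1_l t). f_equal.
  destruct z; apply injective_projections; simpl; ring.
Qed.

(** The variable of Euler's integral is [x^2] here, which is what makes [sol_I]
    and [sol_J] below gamma functions at 0. *)
Lemma CGamma_Phi_quad (z : C) : 1 <= 2 * Re z ->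
  CGamma z = (2 * Phi (2 * Re z) (2 * Im z) 1 0)%C.
Proof.
  intros Hz. apply (CGamma_exp_subst 2); [lra|].
  eapply is_RInt_gen_ext; [|apply (is_int_line_linear (Cmult 2) (is_linear_Cmult 2));
    apply is_int_line_Phi; [exact Hz|apply coercive_quad]].
  apply filter_forall. intros [x y] t _. unfold kernel. f_equal. f_equal.
  replace (2 * t) with (t + t) by ring. rewrite exp_plus.
  destruct z; apply injective_projections; simpl; ring.
Qed.

Lemma Phi_conj k g e l : 1 <= k -> coercive (Re l) e ->
  Phi k (- g) e (Cconj l) = Cconj (Phi k g e l).
Proof.
  intros Hk He. apply is_int_line_unique with (kernel k (- g) e (Cconj l)).
  - apply is_int_line_Phi; assumption.
  - eapply is_RInt_gen_ext;
      [|apply (is_int_line_linear Cconj is_linear_Cconj); try typeclasses eauto;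
        apply is_int_line_Phi; assumption].
    apply filter_forall. intros [x y] t _. unfold kernel, Cexp, Cconj; simpl.
    replace (- g * t - - snd l * exp t) with (- (g * t - Im l * exp t))
      by (unfold Im; ring).
    rewrite cos_neg, sin_neg. unfold Re. f_equal. ring.
Qed.

(** * Bounds and dependence on the parameters *)
Lemma Phi_1_real (a : R) : 0 < a -> Phi 1 0 0 a = RtoC (/ a).
Proof.
  intros Ha. apply is_int_line_unique with (kernel 1 0 0 a).
  { apply is_int_line_Phi; [lra|]. apply coercive_lin. exact Ha. }
  assert (Hlim : forall (h : R -> R) (F : (R -> Prop) -> Prop) x, filterlim h F (locally x) ->
    filterlim (fun t => scal (h t) (RtoC 1) : C_R_NormedModule) F
      (locally (scal x (RtoC 1) : C_R_NormedModule))).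
  { intros h F x Hh.
    exact (filterlim_comp _ _ _ h (fun x => scal x (RtoC 1) : C_R_NormedModule) F _ _ Hh
      (filterlim_scal_l (K := R_AbsRing) (V := C_R_NormedModule) x (RtoC 1))). }
  pose proof (is_RInt_gen_antiderivative (V := C_R_CompleteNormedModule)
    (Rbar_locally m_infty) (Rbar_locally p_infty)
    (fun t => scal (- exp (- a * exp t) / a) (RtoC 1)) (kernel 1 0 0 a)
    (scal (- / a) (RtoC 1)) (scal 0 (RtoC 1))) as H.
  eapply eq_ind; [apply H|].
  - intros t.
    replace (kernel 1 0 0 a t) with (scal (exp t * exp (- a * exp t)) (RtoC 1)
      : C_R_CompleteNormedModule).
    + apply (is_derive_scal_l (V := C_R_NormedModule)). auto_derive; trivial.
      field. lra.
    + rewrite scal_R_Cmult. unfold kernel, Cexp; simpl.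
      rewrite <- exp_plus. replace (0 * t - 0 * exp t) with 0 by ring.
      rewrite cos_0, sin_0.
      replace (1 * t - a * exp t - 0 * (exp t * (exp t * 1))) with (t + - a * exp t) by ring.
      apply injective_projections; simpl; ring.
  - apply continuous_kernel.
  - apply Hlim.
    replace (- / a) with (- exp (- a * 0) / a) by (rewrite Rmult_0_r, exp_0; field; lra).
    apply (is_lim_comp_continuous exp (fun x => - exp (- a * x) / a) m_infty 0).
    + apply is_lim_exp_m.
    + apply (ex_derive_continuous (fun x => - exp (- a * x) / a)). auto_derive; trivial.
  - apply Hlim.
    replace 0 with (- 0 / a) by (field; lra).
    assert (Hl : is_lim (fun t => exp (- a * exp t)) p_infty 0).
    { apply (is_lim_comp exp (fun t => - a * exp t) p_infty 0 m_infty).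
      - apply is_lim_exp_m.
      - replace m_infty with (Rbar_mult (- a) p_infty).
        + apply is_lim_scal_l, is_lim_exp_p.
        + apply is_Rbar_mult_unique. apply is_Rbar_mult_sym.
          apply is_Rbar_mult_p_infty_neg. simpl. lra.
      - exists 0. intros; discriminate. }
    apply (is_lim_comp_continuous (fun t => exp (- a * exp t)) (fun x => - x / a) p_infty 0).
    + exact Hl.
    + apply (ex_derive_continuous (fun x => - x / a)). auto_derive; trivial.
  - rewrite !scal_R_Cmult, !Cmult_1_r. change (RtoC 0 - RtoC (- / a) = RtoC (/ a))%C.
    rewrite RtoC_opp. ring.
Qed.

Lemma Phi_2_real (a : R) : 0 < a -> Phi 2 0 0 a = RtoC (/ a ^ 2).
Proof.
  intros Ha. pose proof (coercive_lin a Ha) as Hc.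
  pose proof (Phi_by_parts 1 0 0 a (Rle_refl 1) Hc) as H.
  rewrite (Phi_1_real a Ha) in H. replace (1 + 1) with 2 in H by ring.
  rewrite Rmult_0_r, Cmult_0_l, Cplus_0_r in H.
  apply (f_equal (Cmult (/ a))) in H.
  rewrite Cmult_assoc, Cinv_l, Cmult_1_l in H.
  - rewrite H. rewrite <- RtoC_inv by lra. apply injective_projections; simpl; field; lra.
  - intros E. apply RtoC_inj in E. lra.
Qed.

Lemma Phi_3_real (a : R) : 0 < a -> Phi 3 0 0 a = RtoC (2 / a ^ 3).
Proof.
  intros Ha. pose proof (coercive_lin a Ha) as Hc.
  assert (H2 : 1 <= 2) by lra.
  pose proof (Phi_by_parts 2 0 0 a H2 Hc) as H.
  rewrite (Phi_2_real a Ha) in H. replace (2 + 1) with 3 in H by ring.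
  rewrite Rmult_0_r, Cmult_0_l, Cplus_0_r in H.
  apply (f_equal (Cmult (/ a))) in H.
  rewrite Cmult_assoc, Cinv_l, Cmult_1_l in H.
  - rewrite H. rewrite <- RtoC_inv by lra. apply injective_projections; simpl; field; lra.
  - intros E. apply RtoC_inj in E. lra.
Qed.

(** Comparison with the positive integrals that the three preceding lemmas
    evaluate. *)
Lemma int_line_le (f : R -> C) (v : C) (k a : R) : 1 <= k -> 0 < a ->
  (forall t, Cmod (f t) <= exp (k * t - a * exp t)) ->
  is_Cint_line f v ->
  Cmod v <= Re (Phi k 0 0 a).
Proof.
  intros Hk Ha Hf Hv. rewrite <- norm_C.
  apply (RInt_gen_norm (V := C_R_CompleteNormedModule)
    (Fa := Rbar_locally m_infty) (Fb := Rbar_locally p_infty)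
    f (fun t => Re (kernel k 0 0 a t))).
  - exists (fun x => x < 0) (fun x => 0 < x); [now exists 0|now exists 0|].
    simpl; intros; lra.
  - apply filter_forall. intros [x y] t _. rewrite norm_C.
    eapply Rle_trans; [apply Hf|]. unfold kernel, Cexp; simpl.
    replace (0 * t - 0 * exp t) with 0 by ring. rewrite cos_0, Rmult_1_r.
    apply exp_le. lra.
  - exact Hv.
  - apply (is_int_line_linear Re is_linear_Re).
    apply is_int_line_Phi; [exact Hk|apply coercive_lin; exact Ha].
Qed.

Lemma Cmod_Phi_le k g e l : 1 <= k -> 0 < Re l -> 0 <= e ->
  Cmod (Phi k g e l) <= Re (Phi k 0 0 (Re l)).
Proof.
  intros Hk Hl He. apply int_line_le with (kernel k g e l); auto.
  - intros t. rewrite Cmod_kernel. apply exp_le. pose proof (pow2_ge_0 (exp t)). nra.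
  - apply is_int_line_Phi; [exact Hk|]. exists (Re l), 0. split; [exact Hl|].
    intros x _. pose proof (pow2_ge_0 x). nra.
Qed.

(** [0 <= 1 - e^(- x^2) <= x^2]: dropping the Gaussian factor costs two powers
    of [x]. *)
Lemma Phi_quad_minus_lin g l : 0 < Re l ->
  Cmod (Phi 1 g 1 l - Phi 1 g 0 l) <= Re (Phi 3 0 0 (Re l)).
Proof.
  intros Hl. apply int_line_le with (fun t => kernel 1 g 1 l t - kernel 1 g 0 l t)%C; try lra.
  - intros t.
    assert (E : kernel 1 g 1 l t = (kernel 1 g 0 l t * RtoC (exp (- exp t ^ 2)))%C).
    { replace (RtoC (exp (- exp t ^ 2))) with (Cexp (RtoC (- exp t ^ 2))).
      - unfold kernel. rewrite <- Cexp_add. f_equal. apply injective_projections; simpl; ring.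
      - unfold Cexp. simpl. rewrite cos_0, sin_0. apply injective_projections; simpl; ring. }
    rewrite E. replace (kernel 1 g 0 l t * RtoC (exp (- exp t ^ 2)) - kernel 1 g 0 l t)%C
      with (kernel 1 g 0 l t * RtoC (exp (- exp t ^ 2) - 1))%C
      by (rewrite RtoC_minus; ring).
    rewrite Cmod_mult, Cmod_kernel, Cmod_R.
    apply Rle_trans with (exp (1 * t - Re l * exp t - 0 * exp t ^ 2) * exp t ^ 2).
    + apply Rmult_le_compat_l; [left; apply exp_pos|].
      pose proof (exp_ineq1_le (- exp t ^ 2)). pose proof (pow2_ge_0 (exp t)).
      assert (exp (- exp t ^ 2) <= 1) by (rewrite <- exp_0; apply exp_le; lra).
      rewrite Rabs_left1 by lra. lra.
    + replace (exp t ^ 2) with (exp (2 * t)) at 2.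
      * rewrite <- exp_plus. apply exp_le. lra.
      * replace (2 * t) with (t + t) by ring. rewrite exp_plus. ring.
  - apply (is_RInt_gen_minus (V := C_R_NormedModule)); apply is_int_line_Phi; try lra.
    + apply coercive_quad.
    + apply coercive_lin, Hl.
Qed.

Lemma is_derive_Re (f : R -> C) s d :
  is_derive (V := C_R_NormedModule) f s d -> is_derive (fun s => Re (f s)) s (Re d).
Proof. apply (is_derive_linear (U := C_R_NormedModule) (V := R_NormedModule) Re is_linear_Re). Qed.

Lemma is_derive_Im (f : R -> C) s d :
  is_derive (V := C_R_NormedModule) f s d -> is_derive (fun s => Im (f s)) s (Im d).
Proof. apply (is_derive_linear (U := C_R_NormedModule) (V := R_NormedModule) Im is_linear_Im). Qed.

Lemma Cmod_sqr (z : C) : Cmod z ^ 2 = Re z ^ 2 + Im z ^ 2.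
Proof. unfold Cmod. rewrite pow2_sqrt; [reflexivity|]. pose proof (pow2_ge_0 (fst z)).
  pose proof (pow2_ge_0 (snd z)). lra. Qed.

(** [Phi 1 g 0 l] is [l^(- 1 - i g) Gamma(1 + i g)]; only its modulus is needed.
    Along the segment from 1 to [l], the derivative formula and the integration
    by parts give a logarithmic derivative [- (1 + i g) l'/l], whose real part is
    that of [- ln |l| + g arg l]. *)
Lemma Phi_rotation (g : R) (l : C) : 0 < Re l ->
  Cmod (Phi 1 g 0 l) ^ 2 * Cmod l ^ 2 * exp (- 2 * g * atan (Im l / Re l)) =
  Cmod (Phi 1 g 0 1) ^ 2.
Proof.
  intros Hl.
  set (L := fun s : R => (1 + RtoC s * (l - 1))%C).
  set (F := fun s => (Re (Phi 1 g 0 (L s)) ^ 2 + Im (Phi 1 g 0 (L s)) ^ 2) *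
    ((1 + s * (Re l - 1)) ^ 2 + (s * Im l) ^ 2) *
    exp (- 2 * g * atan (s * Im l / (1 + s * (Re l - 1))))).
  assert (HF : F 0 = F 1).
  { apply eq_is_derive; [|lra]. intros s Hs. unfold F.
    assert (Hp : 0 < 1 + s * (Re l - 1)) by nra.
    assert (HL1 : Re (L s) = 1 + s * (Re l - 1)) by (unfold L; simpl; unfold Re; ring).
    assert (HL2 : Im (L s) = s * Im l) by (unfold L; simpl; unfold Re, Im; ring).
    assert (Hc : coercive (Re (L s)) 0) by (apply coercive_lin; lra).
    pose proof (is_derive_Phi 1 g 0 1 (l - 1) s (Rle_refl 1) Hc) as HD.
    pose proof (Phi_by_parts 1 g 0 (L s) (Rle_refl 1) Hc) as HB.
    rewrite Rmult_0_r, Cmult_0_l, Cplus_0_r in HB.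
    change (fun s => Phi 1 g 0 (1 + RtoC s * (l - 1))) with (fun s => Phi 1 g 0 (L s)) in HD.
    fold (L s) in HD.
    set (a2 := Re (Phi (1 + 1) g 0 (L s))). set (b2 := Im (Phi (1 + 1) g 0 (L s))).
    assert (B1 : (1 + s * (Re l - 1)) * a2 - s * Im l * b2
                 = Re (Phi 1 g 0 (L s)) - g * Im (Phi 1 g 0 (L s))).
    { rewrite <- HL1, <- HL2.
      transitivity (Re (L s * Phi (1 + 1) g 0 (L s))); [reflexivity|].
      rewrite HB. simpl. unfold Re, Im. ring. }
    assert (B2 : (1 + s * (Re l - 1)) * b2 + s * Im l * a2
                 = Im (Phi 1 g 0 (L s)) + g * Re (Phi 1 g 0 (L s))).
    { rewrite <- HL1, <- HL2.
      transitivity (Im (L s * Phi (1 + 1) g 0 (L s))); [reflexivity|].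
      rewrite HB. simpl. unfold Re, Im. ring. }
    set (u := fun s => Re (Phi 1 g 0 (L s))).
    set (v := fun s => Im (Phi 1 g 0 (L s))).
    assert (H1 : is_derive u s
      (- ((Re l - 1) * a2 - Im l * b2))).
    { eapply eq_ind; [exact (is_derive_Re _ _ _ HD)|].
      unfold a2, b2. simpl. unfold Re, Im. ring. }
    assert (H2 : is_derive v s
      (- ((Re l - 1) * b2 + Im l * a2))).
    { eapply eq_ind; [exact (is_derive_Im _ _ _ HD)|].
      unfold a2, b2. simpl. unfold Re, Im. ring. }
    apply is_derive_ext with (f := fun s => (u s ^ 2 + v s ^ 2) *
      ((1 + s * (Re l - 1)) ^ 2 + (s * Im l) ^ 2) *
      exp (- 2 * g * atan (s * Im l / (1 + s * (Re l - 1))))); [reflexivity|].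
    auto_derive.
    - repeat split; try (eexists; eassumption). lra.
      change (Derive (fun x => u x) s) with (Derive u s).
      change (Derive (fun x => v x) s) with (Derive v s).
      rewrite (is_derive_unique u _ _ H1), (is_derive_unique v _ _ H2).
      change (Re (Phi 1 g 0 (L s))) with (u s) in *.
      change (Im (Phi 1 g 0 (L s))) with (v s) in *.
      set (p := 1 + s * (Re l - 1)) in *. set (q := s * Im l) in *.
      set (m1 := Re l - 1). set (m2 := Im l).
      assert (HN : 0 < p ^ 2 + q ^ 2) by (pose proof (pow2_ge_0 q); nra).
      replace ((1 * m2 * / p + q * (- (1 * m1) * / (p * p))) */ (1 + q * / p * (q * / p * 1)))
        with ((m2 * p - q * m1) / (p ^ 2 + q ^ 2)) by (field; repeat split; nra).
      set (E := exp _).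
      assert (Ha : a2 * (p ^ 2 + q ^ 2) = p * (u s - g * v s) + q * (v s + g * u s))
        by (rewrite <- B1, <- B2; ring).
      assert (Hb : b2 * (p ^ 2 + q ^ 2) = p * (v s + g * u s) - q * (u s - g * v s))
        by (rewrite <- B1, <- B2; ring).
      transitivity (E * (-2 * (u s * (m1 * (a2 * (p ^ 2 + q ^ 2)) - m2 * (b2 * (p ^ 2 + q ^ 2)))
        + v s * (m1 * (b2 * (p ^ 2 + q ^ 2)) + m2 * (a2 * (p ^ 2 + q ^ 2))))
        + (u s ^ 2 + v s ^ 2) * (2 * (m1 * p + m2 * q) - 2 * g * (m2 * p - q * m1)))).
      + field. lra.
      + rewrite Ha, Hb. change (zero : R) with 0. ring. }
  unfold F in HF. rewrite !Cmod_sqr.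
  replace (L 0) with (RtoC 1) in HF by (unfold L; ring).
  replace (L 1) with l in HF by (unfold L; ring).
  rewrite !Rmult_0_l, Rmult_1_l, Rmult_1_l, Rplus_0_r in HF.
  replace (0 / 1) with 0 in HF by field. rewrite atan_0, Rmult_0_r, exp_0 in HF.
  replace (1 + (Re l - 1)) with (Re l) in HF by ring.
  rewrite <- HF. ring.
Qed.

(** [|e^(i g t) - 1| <= |g| |t| <= |g| (e^t + e^(- t))], and the two exponentials
    shift [k] by one; hence [k >= 2]. *)
Lemma Phi_lipschitz k e l : 2 <= k -> coercive (Re l) e ->
  exists M, forall g, Cmod (Phi k g e l - Phi k 0 e l) <= M * Rabs g.
Proof.
  intros Hk He.
  destruct (kernel_dominated (k - 1) (Re l) e) as [M1 HM1]; [lra|exact He|].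
  destruct (kernel_dominated (k + 1) (Re l) e) as [M2 HM2]; [lra|exact He|].
  exists (M1 + M2). intros g.
  destruct (int_line_dominated (V := C_R_CompleteNormedModule)
    (fun t => kernel k g e l t - kernel k 0 e l t)%C ((M1 + M2) * Rabs g)) as [v [Hv Hvn]].
  - intros t. apply (continuous_minus (V := C_R_NormedModule)); apply continuous_kernel.
  - intros t. rewrite norm_C.
    assert (E : kernel k g e l t = (kernel k 0 e l t * Cexp (0, (g * t)%R))%C).
    { unfold kernel. rewrite <- Cexp_add. f_equal. apply injective_projections; simpl; ring. }
    rewrite E.
    replace (kernel k 0 e l t * Cexp (0, (g * t)%R) - kernel k 0 e l t)%C
      with (kernel k 0 e l t * (Cexp (0, (g * t)%R) - 1))%C by ring.
    rewrite Cmod_mult, Cmod_kernel.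
    assert (H : Cmod (Cexp (0, g * t) - 1) <= Rabs g * (exp (- t) + exp t)).
    { apply Rle_trans with (Rabs g * Rabs t).
      - rewrite <- Rabs_mult. apply Cexp_imaginary_sub_1.
      - apply Rmult_le_compat_l; [apply Rabs_pos|].
        pose proof (exp_ineq1_le t). pose proof (exp_ineq1_le (- t)).
        pose proof (exp_pos t). pose proof (exp_pos (- t)).
        unfold Rabs. destruct Rcase_abs; lra. }
    eapply Rle_trans; [apply Rmult_le_compat_l; [left; apply exp_pos|exact H]|].
    specialize (HM1 t). specialize (HM2 t).
    replace ((k - 1) * t - Re l * exp t - e * exp t ^ 2) with
      ((k * t - Re l * exp t - e * exp t ^ 2) + - t) in HM1 by ring.
    replace ((k + 1) * t - Re l * exp t - e * exp t ^ 2) with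
      ((k * t - Re l * exp t - e * exp t ^ 2) + t) in HM2 by ring.
    rewrite exp_plus in HM1, HM2. pose proof (Rabs_pos g). nra.
  - replace (Phi k g e l - Phi k 0 e l)%C with v.
    + rewrite norm_C in Hvn. exact Hvn.
    + apply (is_int_line_unique _ _ _ Hv).
      apply (is_RInt_gen_minus (V := C_R_NormedModule)); apply is_int_line_Phi; auto; lra.
Qed.

(** * The solution decaying at infinity *)

(** The conjugate of [e^(i pi/4)]. *)
Definition wbar : C := (/ sqrt 2, - / sqrt 2).

Definition sol_I (al s : R) : C := Phi 1 (2 * al) 1 (RtoC s * wbar).

(** [i s/2] times [sol_I], plus the derivative of [sol_I]. *)
Definition sol_J (al s : R) : C :=
  ((0%R, (s / 2)%R) * sol_I al s - wbar * Phi 2 (2 * al) 1 (RtoC s * wbar))%C.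

Lemma inv_sqrt2_sqr : / sqrt 2 * / sqrt 2 = / 2.
Proof. rewrite <- Rinv_mult, sqrt_sqrt by lra. reflexivity. Qed.

Lemma is_derive_C_mult (f g : R -> C) s df dg :
  is_derive (V := C_R_NormedModule) f s df -> is_derive (V := C_R_NormedModule) g s dg ->
  is_derive (V := C_R_NormedModule) (fun s => f s * g s)%C s (df * g s + f s * dg)%C.
Proof.
  intros Hf Hg.
  pose proof (is_derive_Re _ _ _ Hf) as F1. pose proof (is_derive_Im _ _ _ Hf) as F2.
  pose proof (is_derive_Re _ _ _ Hg) as G1. pose proof (is_derive_Im _ _ _ Hg) as G2.
  pose proof (is_derive_pair _ _ _ _ _
    (is_derive_minus _ _ _ _ _ (is_derive_mult _ _ _ _ _ F1 G1 Rmult_comm)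
      (is_derive_mult _ _ _ _ _ F2 G2 Rmult_comm))
    (is_derive_plus _ _ _ _ _ (is_derive_mult _ _ _ _ _ F1 G2 Rmult_comm)
      (is_derive_mult _ _ _ _ _ F2 G1 Rmult_comm))) as H.
  eapply is_derive_ext; [|eapply eq_ind; [exact H|]].
  - intros t. reflexivity.
  - unfold minus, plus, opp, mult; simpl; unfold Re, Im.
    apply injective_projections; simpl; ring.
Qed.

Lemma is_derive_Cmod_sqr (f : R -> C) s d :
  is_derive (V := C_R_NormedModule) f s d ->
  is_derive (fun s => Cmod (f s) ^ 2) s (2 * (Re (f s) * Re d + Im (f s) * Im d)).
Proof.
  intros H.
  pose proof (is_derive_Re _ _ _ H) as H1. pose proof (is_derive_Im _ _ _ H) as H2.
  apply is_derive_ext with (f := fun s => Re (f s) ^ 2 + Im (f s) ^ 2).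
  { intros t. symmetry. apply Cmod_sqr. }
  set (u := fun s => Re (f s)) in *. set (v := fun s => Im (f s)) in *.
  change (is_derive (fun s => u s ^ 2 + v s ^ 2) s (2 * (u s * Re d + v s * Im d))).
  auto_derive.
  - repeat split; eexists; eassumption.
  - change (Derive (fun x => u x) s) with (Derive u s).
    change (Derive (fun x => v x) s) with (Derive v s).
    rewrite (is_derive_unique u _ _ H1), (is_derive_unique v _ _ H2). ring.
Qed.

Lemma is_derive_Phi_ray k g s : 1 <= k ->
  is_derive (V := C_R_NormedModule) (fun s => Phi k g 1 (RtoC s * wbar)) s
    (- (wbar * Phi (k + 1) g 1 (RtoC s * wbar)))%C.
Proof.
  intros Hk. apply is_derive_ext with (f := fun s => Phi k g 1 (0 + RtoC s * wbar)).
  - intros t. rewrite Cplus_0_l. reflexivity.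
  - eapply eq_ind; [apply (is_derive_Phi k g 1 0 wbar s Hk (coercive_quad _))|].
    rewrite Cplus_0_l. reflexivity.
Qed.

Lemma is_derive_sol_I al s :
  is_derive (V := C_R_NormedModule) (sol_I al) s
    (sol_J al s - (0%R, (s / 2)%R) * sol_I al s)%C.
Proof.
  eapply eq_ind; [apply (is_derive_Phi_ray 1 (2 * al) s); lra|].
  unfold sol_J. replace (1 + 1) with 2 by ring. match goal with |- @eq _ ?x ?y => change (@eq C x y) end. ring.
Qed.

(** Since [wbar^2 = - i], the terms with two and three powers of [x] combine to
    [- i/2] times the left-hand side of the integration by parts. *)
Lemma is_derive_sol_J al s :
  is_derive (V := C_R_NormedModule) (sol_J al) s (RtoC al * sol_I al s)%C.
Proof.
  pose proof (is_derive_Phi_ray 1 (2 * al) s (Rle_refl 1)) as H1.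
  assert (H12 : 1 <= 2) by lra.
  pose proof (is_derive_Phi_ray 2 (2 * al) s H12) as H2.
  assert (H3 : is_derive (V := C_R_NormedModule) (fun s => (0%R, (s / 2)%R)) s (0%R, (/ 2)%R)).
  { apply is_derive_pair; auto_derive; trivial; lra. }
  pose proof (is_derive_minus (V := C_R_NormedModule) _ _ _ _ _
    (is_derive_C_mult _ _ _ _ _ H3 H1)
    (is_derive_linear (V := C_R_NormedModule) (Cmult wbar) (is_linear_Cmult wbar) _ _ _ H2)) as H.
  eapply eq_ind; [exact H|].
  pose proof (Phi_by_parts 1 (2 * al) 1 (RtoC s * wbar) (Rle_refl 1) (coercive_quad _)) as HB.
  unfold sol_I.
  replace (1 + 1) with 2 in * by ring. replace (1 + 2) with (2 + 1) in * by ring.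
  set (P1 := Phi 1 _ _ _) in *. set (P2 := Phi 2 _ _ _) in *. set (P3 := Phi (2 + 1) _ _ _) in *.
  change ((0%R, (/ 2)%R) * P1 + (0%R, (s / 2)%R) * - (wbar * P2) - wbar * - (wbar * P3) = RtoC al * P1)%C.
  assert (Hw : (wbar * wbar = (0%R, (-1)%R))%C).
  { unfold wbar. apply injective_projections; simpl; [|]; pose proof inv_sqrt2_sqr; lra. }
  assert (E : ((0%R, (/ 2)%R) * P1 + (0%R, (s / 2)%R) * - (wbar * P2) - wbar * - (wbar * P3) =
    (0%R, (/ 2)%R) * P1 - (0%R, (/ 2)%R) * (RtoC s * wbar * P2 + RtoC (2 * 1) * P3))%C).
  { replace (wbar * - (wbar * P3))%C with (- (wbar * wbar) * P3)%C by ring.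
    rewrite Hw.
    destruct wbar, P1, P2, P3; apply injective_projections; simpl; field. }
  rewrite E, HB. destruct P1; apply injective_projections; simpl; field.
Qed.

(** Both terms have derivative [2 al Re (conj J I)]: the term [- (i s/2) I] of
    [I'] does not change the modulus of [I]. *)
Lemma sol_conserved al s : 0 <= s ->
  Cmod (sol_J al s) ^ 2 - al * Cmod (sol_I al s) ^ 2 =
  Cmod (sol_J al 0) ^ 2 - al * Cmod (sol_I al 0) ^ 2.
Proof.
  intros [Hs|<-]; [|reflexivity]. symmetry.
  apply (eq_is_derive (fun s => Cmod (sol_J al s) ^ 2 - al * Cmod (sol_I al s) ^ 2)); [|exact Hs].
  intros t _.
  pose proof (is_derive_Cmod_sqr _ _ _ (is_derive_sol_I al t)) as HI.
  pose proof (is_derive_Cmod_sqr _ _ _ (is_derive_sol_J al t)) as HJ.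
  eapply eq_ind; [exact (is_derive_minus _ _ _ _ _ HJ (is_derive_scal _ _ al _ HI))|].
  destruct (sol_I al t) as [i1 i2], (sol_J al t) as [j1 j2].
  unfold minus, plus, opp, scal, zero; simpl. unfold Re, Im. simpl. field.
Qed.

Definition gamma_sq (b g : R) : R := Cmod (CGamma (b, g)) ^ 2.

Lemma inv_sqrt2_pos : 0 < / sqrt 2.
Proof. apply Rinv_0_lt_compat, sqrt_lt_R0. lra. Qed.

Lemma Re_ray s : Re (RtoC s * wbar) = s * / sqrt 2.
Proof. simpl. ring. Qed.

Lemma Cmod_wbar : Cmod wbar = 1.
Proof.
  unfold Cmod, wbar; simpl. transitivity (sqrt 1); [|apply sqrt_1]. f_equal.
  pose proof inv_sqrt2_sqr. nra.
Qed.

Lemma sol_I_bound al s : 0 < s -> Cmod (sol_I al s) <= / (s * / sqrt 2).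
Proof.
  intros Hs. pose proof inv_sqrt2_pos as Hk.
  assert (Ha : 0 < s * / sqrt 2) by nra.
  pose proof (Cmod_Phi_le 1 (2 * al) 1 (RtoC s * wbar) (Rle_refl 1)) as H.
  rewrite Re_ray, Phi_1_real in H by exact Ha.
  apply H; lra.
Qed.

(** Up to [O(s^-2)], [J] is [(i s/2) Phi 1 (2 al) 0 (s wbar)], whose modulus does not
    depend on [s] by [Phi_rotation]; the argument [- pi/4] of [wbar] produces the
    factor [e^(- pi al)] in its square. *)
Lemma sol_J_modulus al s : 0 < s ->
  Rabs (Cmod (sol_J al s) - sqrt (exp (- (PI * al)) * gamma_sq 1 (2 * al)) / 2)
    <= 3 / (s * / sqrt 2) ^ 2.
Proof.
  intros Hs. pose proof inv_sqrt2_pos as Hk.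
  assert (Ha : 0 < s * / sqrt 2) by nra.
  set (x := s * / sqrt 2) in *.
  set (P0 := Phi 1 (2 * al) 0 (RtoC s * wbar)).
  assert (HP0 : (s * Cmod P0) ^ 2 = exp (- (PI * al)) * gamma_sq 1 (2 * al)).
  { assert (Hl : 0 < Re (RtoC s * wbar)) by (rewrite Re_ray; exact Ha).
    pose proof (Phi_rotation (2 * al) (RtoC s * wbar) Hl) as H.
    fold P0 in H. unfold gamma_sq. rewrite CGamma_Phi_lin by (simpl; lra).
    change (Re (1, 2 * al)) with 1. change (Im (1, 2 * al)) with (2 * al).
    rewrite <- H, Cmod_mult, Cmod_wbar, Cmod_R, Rabs_pos_eq by lra.
    replace (Im (RtoC s * wbar) / Re (RtoC s * wbar)) with (- (1)).
    2:{ simpl. field. split; [apply Rgt_not_eq, sqrt_lt_R0; lra|lra]. }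
    rewrite atan_opp, atan_1.
    replace (-2 * (2 * al) * - (PI / 4)) with (PI * al) by field.
    rewrite exp_Ropp. field. apply Rgt_not_eq, exp_pos. }
  rewrite <- HP0, sqrt_pow2 by (pose proof (Cmod_ge_0 P0); nra).
  assert (H3 : Cmod (0, s / 2) = s / 2).
  { unfold Cmod; simpl. replace (0 * (0 * 1) + s / 2 * (s / 2 * 1)) with ((s / 2) ^ 2) by ring.
    apply sqrt_pow2. lra. }
  set (D := (sol_J al s - (0%R, (s / 2)%R) * P0)%C).
  assert (HD : Cmod D <= 3 / x ^ 2).
  { replace D with ((0%R, (s / 2)%R) * (sol_I al s - P0)
      - wbar * Phi 2 (2 * al) 1 (RtoC s * wbar))%C by (unfold D, sol_J; ring).
    eapply Rle_trans; [apply Cmod_triangle|]. rewrite Cmod_opp, !Cmod_mult, Cmod_wbar.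
    assert (H1 : Cmod (sol_I al s - P0) <= 2 / x ^ 3).
    { pose proof (Phi_quad_minus_lin (2 * al) (RtoC s * wbar)) as H.
      rewrite Re_ray, Phi_3_real in H by exact Ha. apply H, Ha. }
    assert (H2 : Cmod (Phi 2 (2 * al) 1 (RtoC s * wbar)) <= / x ^ 2).
    { assert (H12 : 1 <= 2) by lra.
      pose proof (Cmod_Phi_le 2 (2 * al) 1 (RtoC s * wbar) H12) as H.
      rewrite Re_ray, Phi_2_real in H by exact Ha. apply H; [exact Ha|lra]. }
    rewrite H3.
    apply Rle_trans with (s / 2 * (2 / x ^ 3) + 1 * / x ^ 2).
    - apply Rplus_le_compat; apply Rmult_le_compat_l; lra.
    - replace (s / 2 * (2 / x ^ 3)) with (sqrt 2 * / x ^ 2).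
      + assert (sqrt 2 <= 2).
        { rewrite <- (sqrt_pow2 2) at 2 by lra. apply sqrt_le_1_alt. lra. }
        assert (0 < / x ^ 2) by (apply Rinv_0_lt_compat, pow_lt, Ha). unfold Rdiv. nra.
      + unfold x. field. split; [apply Rgt_not_eq, sqrt_lt_R0; lra|lra]. }
  assert (HW : Cmod ((0%R, (s / 2)%R) * P0) = s * Cmod P0 / 2)
    by (rewrite Cmod_mult, H3; field).
  rewrite <- HW. clearbody P0.
  set (W := ((0%R, (s / 2)%R) * P0)%C) in *.
  pose proof (Cmod_triangle D W) as T1. pose proof (Cmod_triangle (sol_J al s) (- D)) as T2.
  rewrite Cmod_opp in T2.
  replace (D + W)%C with (sol_J al s) in T1 by (unfold D; ring).
  replace (sol_J al s + - D)%C with W in T2 by (unfold D; ring).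
  apply Rabs_le. lra.
Qed.

Lemma is_lim_inv_ray (c : R) (n : nat) : (0 < n)%nat ->
  is_lim (fun s => c / (s * / sqrt 2) ^ n) p_infty 0.
Proof.
  intros Hn. pose proof inv_sqrt2_pos as Hk.
  assert (H : is_lim (fun s => / (s * / sqrt 2)) p_infty 0).
  { apply (is_lim_inv (fun s => s * / sqrt 2) p_infty p_infty); [|discriminate].
    replace p_infty with (Rbar_mult p_infty (/ sqrt 2)) at 2.
    - apply is_lim_scal_r, is_lim_id.
    - apply is_Rbar_mult_unique, is_Rbar_mult_p_infty_pos. exact Hk. }
  apply is_lim_ext with (fun s => c * (/ (s * / sqrt 2)) ^ n).
  { intros s. unfold Rdiv. rewrite pow_inv. reflexivity. }
  replace (Finite 0) with (Finite (c * 0 ^ n)) by (rewrite pow_i by exact Hn; f_equal; ring).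
  apply (is_lim_comp_continuous (fun s => / (s * / sqrt 2)) (fun y => c * y ^ n) p_infty 0 H).
  apply (ex_derive_continuous (fun y => c * y ^ n)). auto_derive; trivial.
Qed.

Lemma is_lim_sol_I al : is_lim (fun s => Cmod (sol_I al s)) p_infty 0.
Proof.
  apply (is_lim_le_le_loc (fun _ => 0) (fun s => 1 / (s * / sqrt 2) ^ 1)).
  - exists 0. intros s Hs. split; [apply Cmod_ge_0|].
    eapply Rle_trans; [apply sol_I_bound, Hs|]. rewrite pow_1. apply Req_le.
    unfold Rdiv. ring.
  - apply is_lim_const.
  - apply is_lim_inv_ray. lia.
Qed.

Lemma is_lim_sol_J al :
  is_lim (fun s => Cmod (sol_J al s) ^ 2) p_infty (exp (- (PI * al)) * gamma_sq 1 (2 * al) / 4).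
Proof.
  set (G := exp (- (PI * al)) * gamma_sq 1 (2 * al)).
  assert (HG : 0 <= G).
  { apply Rmult_le_pos; [left; apply exp_pos|]. apply pow2_ge_0. }
  replace (G / 4) with ((sqrt G / 2) ^ 2) by (unfold Rdiv; rewrite Rpow_mult_distr, pow2_sqrt by exact HG; field).
  apply (is_lim_comp_continuous (fun s => Cmod (sol_J al s)) (fun x => x ^ 2) p_infty (sqrt G / 2)).
  - assert (H0 : is_lim (fun s => Cmod (sol_J al s) - sqrt G / 2) p_infty 0).
    { apply (is_lim_le_le_loc (fun s => - 3 / (s * / sqrt 2) ^ 2) (fun s => 3 / (s * / sqrt 2) ^ 2)).
      - exists 0. intros s Hs. pose proof (sol_J_modulus al s Hs) as H. fold G in H.
        apply Rabs_le_between in H. unfold Rdiv in *. lra.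
      - apply is_lim_inv_ray. lia.
      - apply is_lim_inv_ray. lia. }
    apply is_lim_ext with (fun s => (Cmod (sol_J al s) - sqrt G / 2) + sqrt G / 2).
    { intros; ring. }
    eapply is_lim_plus; [exact H0|apply is_lim_const|].
    unfold is_Rbar_plus; simpl. f_equal. f_equal. ring.
  - apply (ex_derive_continuous (fun x => x ^ 2)). auto_derive; trivial.
Qed.

Lemma sol_I_0 al : CGamma ((/ 2)%R, al) = (2 * sol_I al 0)%C.
Proof.
  rewrite CGamma_Phi_quad by (simpl; lra).
  change (Re ((/ 2)%R, al)) with (/ 2). change (Im ((/ 2)%R, al)) with al.
  unfold sol_I. rewrite Cmult_0_l. replace (2 * / 2) with 1 by field. reflexivity.
Qed.

Lemma sol_J_0 al : (wbar * CGamma (1, al) = - (2 * sol_J al 0))%C.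
Proof.
  rewrite CGamma_Phi_quad by (simpl; lra).
  change (Re (1, al)) with 1. change (Im (1, al)) with al.
  unfold sol_J. rewrite Cmult_0_l. replace (2 * 1) with 2 by ring.
  replace (0 / 2) with 0 by field. change (0, 0) with (RtoC 0). ring.
Qed.

Lemma gamma_sq_half al : gamma_sq (/ 2) al = 4 * Cmod (sol_I al 0) ^ 2.
Proof.
  unfold gamma_sq. rewrite sol_I_0, Cmod_mult, Cmod_R, Rabs_pos_eq by lra. ring.
Qed.

Lemma gamma_sq_1 al : gamma_sq 1 al = 4 * Cmod (sol_J al 0) ^ 2.
Proof.
  unfold gamma_sq. replace (Cmod (CGamma (1, al))) with (Cmod (wbar * CGamma (1, al))).
  - rewrite sol_J_0, Cmod_opp, Cmod_mult, Cmod_R, Rabs_pos_eq by lra. ring.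
  - rewrite Cmod_mult, Cmod_wbar. ring.
Qed.

(** The conserved quantity [|J|^2 - al |I|^2] at 0 and at infinity. *)
Lemma gamma_sq_relation al :
  gamma_sq 1 al - al * gamma_sq (/ 2) al = exp (- (PI * al)) * gamma_sq 1 (2 * al).
Proof.
  rewrite gamma_sq_1, gamma_sq_half.
  assert (H : is_lim (fun s => Cmod (sol_J al s) ^ 2 - al * Cmod (sol_I al s) ^ 2) p_infty
    (exp (- (PI * al)) * gamma_sq 1 (2 * al) / 4)).
  { eapply is_lim_minus; [apply is_lim_sol_J| |].
    - apply is_lim_scal_l.
      apply (is_lim_comp_continuous (fun s => Cmod (sol_I al s)) (fun x => x ^ 2) p_infty 0).
      + apply is_lim_sol_I.
      + apply (ex_derive_continuous (fun x => x ^ 2)). auto_derive; trivial.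
    - unfold is_Rbar_minus, is_Rbar_plus; simpl. f_equal. f_equal. ring. }
  assert (H' : is_lim (fun s => Cmod (sol_J al s) ^ 2 - al * Cmod (sol_I al s) ^ 2) p_infty
    (Cmod (sol_J al 0) ^ 2 - al * Cmod (sol_I al 0) ^ 2)).
  { apply is_lim_ext_loc with (fun _ => Cmod (sol_J al 0) ^ 2 - al * Cmod (sol_I al 0) ^ 2).
    - exists 0. intros s Hs. symmetry. apply sol_conserved. lra.
    - apply is_lim_const. }
  apply is_lim_unique in H. apply is_lim_unique in H'. rewrite H in H'.
  injection H' as E. lra.
Qed.

(** * The modulus of the gamma function *)
Lemma CGamma_conj (z : C) : 1 <= 2 * Re z -> CGamma (Cconj z) = Cconj (CGamma z).
Proof.
  intros Hz. rewrite !CGamma_Phi_quad by exact Hz.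
  rewrite Cmult_conj, <- Phi_conj by (try apply coercive_quad; exact Hz).
  change (Re (Cconj z)) with (Re z). change (Im (Cconj z)) with (- Im z).
  replace (2 * - Im z) with (- (2 * Im z)) by ring.
  replace (Cconj 2) with (RtoC 2) by (apply injective_projections; simpl; ring).
  replace (Cconj 0) with (RtoC 0) by (apply injective_projections; simpl; ring).
  reflexivity.
Qed.

Lemma gamma_sq_even b g : 1 <= 2 * b -> gamma_sq b (- g) = gamma_sq b g.
Proof.
  intros Hb. unfold gamma_sq. change (b, - g) with (Cconj (b, g)).
  rewrite CGamma_conj by exact Hb. rewrite Cmod_conj. reflexivity.
Qed.

Lemma exp_opp_sinh_cosh y : exp (- y) = cosh y - sinh y /\ exp y = cosh y + sinh y.
Proof. unfold cosh, sinh. split; field. Qed.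

(** Half-sum and half-difference of the relations for [al] and [- al], as the
    moduli are even in [al]. *)
Lemma gamma_sq_double al :
  gamma_sq 1 al = cosh (PI * al) * gamma_sq 1 (2 * al) /\
  al * gamma_sq (/ 2) al = sinh (PI * al) * gamma_sq 1 (2 * al).
Proof.
  pose proof (gamma_sq_relation al) as H1. pose proof (gamma_sq_relation (- al)) as H2.
  replace (2 * - al) with (- (2 * al)) in H2 by ring.
  rewrite !gamma_sq_even in H2 by lra.
  replace (- (PI * - al)) with (PI * al) in H2 by ring.
  destruct (exp_opp_sinh_cosh (PI * al)) as [E1 E2]. rewrite E1 in H1. rewrite E2 in H2.
  split; lra.
Qed.

Lemma sinh_double y : sinh (2 * y) = 2 * sinh y * cosh y.
Proof.
  unfold sinh, cosh. replace (2 * y) with (y + y) by ring.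
  replace (- (y + y)) with (- y + - y) by ring. rewrite !exp_plus. field.
Qed.

(** [D x = 2^n D (x / 2^n) = O(2^n / 4^n)]. *)
Lemma doubling_zero (D : R -> R) (K : R) :
  (forall x, D (2 * x) = 2 * D x) -> (forall x, Rabs x <= 1 -> Rabs (D x) <= K * x ^ 2) ->
  forall x, D x = 0.
Proof.
  intros HD HK x.
  assert (Hn : forall n, D x = 2 ^ n * D (x * (/ 2) ^ n)).
  { induction n as [|n IH]; simpl; [rewrite !Rmult_1_r; ring|].
    rewrite IH. replace (x * (/ 2) ^ n) with (2 * (x * (/ 2 * (/ 2) ^ n))) by field.
    rewrite HD. ring. }
  assert (H0 : is_lim_seq (fun n => (/ 2) ^ n) 0).
  { apply is_lim_seq_geom. rewrite Rabs_pos_eq; lra. }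
  assert (H1 : is_lim_seq (fun n => K * x ^ 2 * (/ 2) ^ n) 0).
  { replace (Finite 0) with (Rbar_mult (K * x ^ 2) 0) by (simpl; f_equal; ring).
    apply is_lim_seq_scal_l, H0. }
  assert (H2 : is_lim_seq (fun n => x * (/ 2) ^ n) 0).
  { replace (Finite 0) with (Rbar_mult x 0) by (simpl; f_equal; ring).
    apply is_lim_seq_scal_l, H0. }
  assert (H3 : is_lim_seq (fun _ => Rabs (D x)) 0).
  { apply is_lim_seq_le_le_loc with (fun _ => 0) (fun n => K * x ^ 2 * (/ 2) ^ n).
    - apply is_lim_seq_spec in H2. destruct (H2 (mkposreal 1 Rlt_0_1)) as [N HN].
      exists N. intros n Hn'. split; [apply Rabs_pos|].
      specialize (HN n Hn'). simpl in HN. rewrite Rminus_0_r in HN.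
      rewrite (Hn n), Rabs_mult, (Rabs_pos_eq (2 ^ n)) by (apply pow_le; lra).
      eapply Rle_trans; [apply Rmult_le_compat_l; [apply pow_le; lra|apply HK; lra]|].
      apply Req_le. rewrite Rpow_mult_distr.
      replace (((/ 2) ^ n) ^ 2) with ((/ 2) ^ n * (/ 2) ^ n) by ring.
      assert (E : 2 ^ n * (/ 2) ^ n = 1).
      { rewrite <- Rpow_mult_distr, Rinv_r, pow1 by lra. reflexivity. }
      transitivity (K * x ^ 2 * (/ 2) ^ n * (2 ^ n * (/ 2) ^ n)); [ring|rewrite E; ring].
    - apply is_lim_seq_const.
    - exact H1. }
  pose proof (is_lim_seq_unique _ _ H3) as E. rewrite Lim_seq_const in E.
  injection E as E. revert E. unfold Rabs. destruct Rcase_abs; lra.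
Qed.

Lemma exp_taylor2 y : Rabs (exp y - 1 - y) <= y ^ 2 * exp (Rabs y).
Proof.
  pose proof (Cexp_taylor2 (RtoC y)) as H.
  replace (Cexp (RtoC y) - 1 - RtoC y)%C with (RtoC (exp y - 1 - y)) in H.
  - rewrite !Cmod_R, pow2_abs in H. exact H.
  - unfold Cexp; simpl. rewrite cos_0, sin_0. apply injective_projections; simpl; ring.
Qed.

Lemma sinh_taylor y : Rabs (sinh y - y) <= y ^ 2 * exp (Rabs y).
Proof.
  pose proof (exp_taylor2 y) as H1. pose proof (exp_taylor2 (- y)) as H2.
  rewrite Rabs_Ropp in H2. replace ((- y) ^ 2) with (y ^ 2) in H2 by ring.
  apply Rabs_le_between in H1. apply Rabs_le_between in H2.
  apply Rabs_le. unfold sinh. lra.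
Qed.

Lemma CGamma_1 : CGamma (1, 0) = 1.
Proof.
  rewrite CGamma_Phi_lin by (simpl; lra).
  change (Re (1, 0)) with 1. change (Im (1, 0)) with 0.
  rewrite Phi_1_real by lra. f_equal. field.
Qed.

Lemma gamma_sq_near_0 b : 1 <= b -> exists M, 0 <= M /\
  forall g, Rabs g <= 1 -> Rabs (gamma_sq b g - gamma_sq b 0) <= M * Rabs g.
Proof.
  intros Hb. assert (Hk : 2 <= 2 * b) by lra.
  destruct (Phi_lipschitz (2 * b) 1 0 Hk (coercive_quad _)) as [M HM].
  assert (HM0 : 0 <= M).
  { specialize (HM 1). rewrite Rabs_R1, Rmult_1_r in HM.
    eapply Rle_trans; [apply Cmod_ge_0|exact HM]. }
  unfold gamma_sq. set (r0 := Cmod (CGamma (b, 0))).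
  assert (Hr0 : 0 <= r0) by apply Cmod_ge_0.
  exists (4 * M * (4 * M + 2 * r0)). split; [nra|]. intros g Hg.
  assert (H : Cmod (CGamma (b, g) - CGamma (b, 0)) <= 4 * M * Rabs g).
  { rewrite !CGamma_Phi_quad by (simpl; lra).
    change (Re (b, g)) with b. change (Re (b, 0)) with b.
    change (Im (b, g)) with g. change (Im (b, 0)) with 0. rewrite Rmult_0_r.
    replace (2 * Phi (2 * b) (2 * g) 1 0 - 2 * Phi (2 * b) 0 1 0)%C
      with (2 * (Phi (2 * b) (2 * g) 1 0 - Phi (2 * b) 0 1 0))%C by ring.
    rewrite Cmod_mult, Cmod_R, Rabs_pos_eq by lra.
    specialize (HM (2 * g)). rewrite Rabs_mult, (Rabs_pos_eq 2) in HM by lra. lra. }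
  pose proof (Cmod_triangle (CGamma (b, g) - CGamma (b, 0)) (CGamma (b, 0))) as T1.
  pose proof (Cmod_triangle (CGamma (b, g)) (- (CGamma (b, g) - CGamma (b, 0)))) as T2.
  rewrite Cmod_opp in T2.
  replace (CGamma (b, g) - CGamma (b, 0) + CGamma (b, 0))%C with (CGamma (b, g)) in T1 by ring.
  replace (CGamma (b, g) + - (CGamma (b, g) - CGamma (b, 0)))%C with (CGamma (b, 0))
    in T2 by ring.
  fold r0 in T1, T2. set (r := Cmod (CGamma (b, g))) in *.
  assert (Hr : 0 <= r) by apply Cmod_ge_0.
  pose proof (Rabs_pos g).
  replace (r ^ 2 - r0 ^ 2) with ((r - r0) * (r + r0)) by ring.
  rewrite Rabs_mult, (Rabs_pos_eq (r + r0)) by lra.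
  assert (Rabs (r - r0) <= 4 * M * Rabs g) by (apply Rabs_le; lra).
  assert (r + r0 <= 4 * M + 2 * r0) by nra.
  pose proof (Rabs_pos (r - r0)).
  apply Rle_trans with (4 * M * Rabs g * (4 * M + 2 * r0)); [|apply Req_le; ring].
  apply Rmult_le_compat; lra.
Qed.

(** The difference of the two sides satisfies [D (2 x) = 2 D x], by the doubling
    formula for the modulus and [sinh (2 y) = 2 sinh y cosh y], and it is
    quadratically small at 0. *)
Lemma gamma_sq_1_reflection al : gamma_sq 1 al * sinh (PI * al) = PI * al.
Proof.
  destruct (gamma_sq_near_0 1 (Rle_refl 1)) as [M [HM0 HM]].
  assert (H1 : gamma_sq 1 0 = 1) by (unfold gamma_sq; rewrite CGamma_1, Cmod_1; ring).
  rewrite H1 in HM.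
  pose proof PI_RGT_0 as HPI. pose proof (exp_pos PI) as HE.
  cut (gamma_sq 1 al * sinh (PI * al) - PI * al = 0); [lra|].
  apply (doubling_zero (fun x => gamma_sq 1 x * sinh (PI * x) - PI * x)
    (M * (PI + PI ^ 2 * exp PI) + PI ^ 2 * exp PI)).
  - intros x. replace (PI * (2 * x)) with (2 * (PI * x)) by ring.
    rewrite sinh_double, (proj1 (gamma_sq_double x)). ring.
  - intros x Hx. specialize (HM x Hx).
    assert (HS : Rabs (sinh (PI * x) - PI * x) <= PI ^ 2 * exp PI * x ^ 2).
    { eapply Rle_trans; [apply sinh_taylor|].
      rewrite Rabs_mult, (Rabs_pos_eq PI) by lra.
      assert (exp (PI * Rabs x) <= exp PI) by (apply exp_le; nra).
      replace ((PI * x) ^ 2) with (PI ^ 2 * x ^ 2) by ring.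
      pose proof (pow2_ge_0 x). pose proof (pow2_ge_0 PI).
      apply Rle_trans with (PI ^ 2 * x ^ 2 * exp PI); [|apply Req_le; ring].
      apply Rmult_le_compat_l; [nra|assumption]. }
    assert (HS2 : Rabs (sinh (PI * x)) <= (PI + PI ^ 2 * exp PI) * Rabs x).
    { replace (sinh (PI * x)) with ((sinh (PI * x) - PI * x) + PI * x) by ring.
      eapply Rle_trans; [apply Rabs_triang|].
      rewrite (Rabs_mult PI x), (Rabs_pos_eq PI) by lra.
      assert (x ^ 2 <= Rabs x) by (rewrite <- pow2_abs; pose proof (Rabs_pos x); nra).
      assert (0 < PI ^ 2 * exp PI) by (apply Rmult_lt_0_compat; [apply pow_lt, HPI|exact HE]).
      nra. }
    replace (gamma_sq 1 x * sinh (PI * x) - PI * x)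
      with ((gamma_sq 1 x - 1) * sinh (PI * x) + (sinh (PI * x) - PI * x)) by ring.
    eapply Rle_trans; [apply Rabs_triang|]. rewrite Rabs_mult.
    rewrite (Rmult_plus_distr_r _ _ (x ^ 2)). apply Rplus_le_compat; [|exact HS].
    apply Rle_trans with (M * Rabs x * ((PI + PI ^ 2 * exp PI) * Rabs x)).
    + apply Rmult_le_compat; auto using Rabs_pos.
    + rewrite <- (pow2_abs x). apply Req_le. ring.
Qed.

Lemma CGamma_succ (z : C) : 1 <= 2 * Re z -> (CGamma (z + 1) = z * CGamma z)%C.
Proof.
  intros Hz. rewrite (CGamma_Phi_quad z Hz), (CGamma_Phi_quad (z + 1))
    by (unfold Re in *; simpl; lra).
  pose proof (Phi_by_parts (2 * Re z) (2 * Im z) 1 0 Hz (coercive_quad _)) as H.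
  replace (2 * Re (z + 1)) with (2 * Re z + 2) by (simpl; unfold Re; ring).
  replace (2 * Im (z + 1)) with (2 * Im z) by (simpl; unfold Im; ring).
  rewrite Cmult_0_l, Cplus_0_l, Rmult_1_r in H. rewrite H.
  replace (2 * Re z, 2 * Im z) with (2 * z)%C
    by (apply injective_projections; simpl; unfold Re, Im; ring).
  ring.
Qed.

Lemma cosh_pos y : 0 < cosh y.
Proof. unfold cosh. pose proof (exp_pos y). pose proof (exp_pos (- y)). lra. Qed.

Lemma gamma_sq_half_reflection al : al <> 0 -> gamma_sq (/ 2) al * cosh (PI * al) = PI.
Proof.
  intros Ha. apply Rmult_eq_reg_l with al; [|exact Ha].
  rewrite <- Rmult_assoc, (proj2 (gamma_sq_double al)).
  pose proof (gamma_sq_1_reflection (2 * al)) as H.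
  replace (PI * (2 * al)) with (2 * (PI * al)) in H by ring.
  rewrite sinh_double in H. lra.
Qed.

Lemma gamma_sq_three_halves g :
  gamma_sq (3 / 2) g = (/ 4 + g ^ 2) * gamma_sq (/ 2) g.
Proof.
  unfold gamma_sq. replace (3 / 2, g) with (((/ 2)%R, g) + 1)%C.
  - rewrite CGamma_succ by (simpl; lra). rewrite Cmod_mult, Rpow_mult_distr. f_equal.
    rewrite Cmod_sqr. simpl. field.
  - apply injective_projections; simpl; field.
Qed.

(** The limit of [gamma_sq_half_reflection] at 0.  Continuity is taken at
    [3/2 + i g], where [Phi_lipschitz] applies, and brought back to [1/2 + i g]
    by the functional equation. *)
Lemma gamma_sq_half_0 : gamma_sq (/ 2) 0 = PI.
Proof.
  assert (H1 : 1 <= 3 / 2) by lra.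
  destruct (gamma_sq_near_0 (3 / 2) H1) as [M [HM0 HM]].
  assert (HG : is_lim (gamma_sq (3 / 2)) 0 (gamma_sq (3 / 2) 0)).
  { assert (HL : forall c, is_lim (fun g => gamma_sq (3 / 2) 0 + c * Rabs g) 0
                   (gamma_sq (3 / 2) 0)).
    { intros c. set (F := fun g => gamma_sq (3 / 2) 0 + c * Rabs g).
      assert (H : is_lim F 0 (F 0)).
      { apply is_lim_continuity, continuity_pt_filterlim.
        apply (continuous_plus (V := R_NormedModule)).
        - apply continuous_const.
        - apply (continuous_scal_r (V := R_NormedModule)), continuous_Rabs. }
      replace (F 0) with (gamma_sq (3 / 2) 0) in H by (unfold F; rewrite Rabs_R0; ring).
      exact H. }
    apply is_lim_le_le_loc with (fun g => gamma_sq (3 / 2) 0 + - M * Rabs g)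
      (fun g => gamma_sq (3 / 2) 0 + M * Rabs g).
    - exists (mkposreal 1 Rlt_0_1). intros g Hg _.
      assert (Hg' : Rabs (g - 0) < 1) by exact Hg. rewrite Rminus_0_r in Hg'.
      specialize (HM g (Rlt_le _ _ Hg')). apply Rabs_le_between in HM. lra.
    - apply HL.
    - apply HL. }
  assert (HF : is_lim (gamma_sq (3 / 2)) 0 ((/ 4 + 0 ^ 2) * (PI / cosh (PI * 0)))).
  { apply is_lim_ext_loc with (fun g => (/ 4 + g ^ 2) * (PI / cosh (PI * g))).
    - exists (mkposreal 1 Rlt_0_1). intros g _ Hg.
      rewrite gamma_sq_three_halves. f_equal.
      pose proof (gamma_sq_half_reflection g Hg) as E. pose proof (cosh_pos (PI * g)) as Hc.
      apply Rmult_eq_reg_r with (cosh (PI * g)); [|lra].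
      rewrite E. field. lra.
    - apply (is_lim_continuity (fun g => (/ 4 + g ^ 2) * (PI / cosh (PI * g)))).
      apply continuity_pt_filterlim.
      apply (ex_derive_continuous (fun g => (/ 4 + g ^ 2) * (PI / cosh (PI * g)))).
      unfold cosh. auto_derive.
      apply Rgt_not_eq. apply (cosh_pos (PI * 0)). }
  apply is_lim_unique in HG. apply is_lim_unique in HF. rewrite HG in HF.
  injection HF as E. rewrite gamma_sq_three_halves in E.
  rewrite Rmult_0_r, cosh_0 in E. lra.
Qed.

(** The square of the modulus being known, it remains that the value is real,
    by conjugation, and nonnegative, as the integral of a positive function. *)
Lemma CGamma_half : CGamma (RtoC (/ 2)) = RtoC (sqrt PI).
Proof.
  assert (Him : Im (CGamma (RtoC (/ 2))) = 0).
  { pose proof (CGamma_conj (RtoC (/ 2))) as H.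
    change (Re (RtoC (/ 2))) with (/ 2) in H.
    replace (Cconj (RtoC (/ 2))) with (RtoC (/ 2)) in H by (apply injective_projections; simpl; ring).
    assert (H' : 1 <= 2 * / 2) by lra. specialize (H H').
    apply (f_equal Im) in H.
    change (Im (CGamma (RtoC (/ 2))) = - Im (CGamma (RtoC (/ 2)))) in H. lra. }
  assert (Hre : 0 <= Re (CGamma (RtoC (/ 2)))).
  { rewrite CGamma_Phi_quad by (simpl; lra).
    change (Re (RtoC (/ 2))) with (/ 2). change (Im (RtoC (/ 2))) with 0.
    replace (2 * / 2) with 1 by field. rewrite Rmult_0_r.
    change (0 <= 2 * Re (Phi 1 0 1 0) - 0 * Im (Phi 1 0 1 0)).
    assert (H : Cmod (Phi 1 0 1 0) <= Re (Phi 1 0 1 0)).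
    { rewrite <- norm_C. apply (RInt_gen_norm (V := C_R_CompleteNormedModule)
        (Fa := Rbar_locally m_infty) (Fb := Rbar_locally p_infty)
        (kernel 1 0 1 0) (fun t => Re (kernel 1 0 1 0 t))).
      - exists (fun x => x < 0) (fun x => 0 < x); [now exists 0|now exists 0|].
        simpl; intros; lra.
      - apply filter_forall. intros [x y] t _. rewrite norm_C, Cmod_kernel.
        unfold kernel, Cexp; simpl. replace (0 * t - 0 * exp t) with 0 by ring.
        rewrite cos_0, Rmult_1_r. lra.
      - apply is_int_line_Phi; [lra|apply coercive_quad].
      - apply (is_int_line_linear Re is_linear_Re).
        apply is_int_line_Phi; [lra|apply coercive_quad]. }
    pose proof (Cmod_ge_0 (Phi 1 0 1 0)). lra. }
  pose proof gamma_sq_half_0 as H. unfold gamma_sq in H. rewrite Cmod_sqr in H.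
  change (/ 2, 0) with (RtoC (/ 2)) in H. rewrite Him in H.
  rewrite (surjective_pairing (CGamma (RtoC (/ 2)))). unfold RtoC at 3. f_equal.
  - rewrite <- H. symmetry. change (fst (CGamma (RtoC (/ 2)))) with (Re (CGamma (RtoC (/ 2)))).
    rewrite <- (sqrt_pow2 _ Hre) at 2. f_equal. ring.
  - exact Him.
Qed.

(** * The Frenet system *)
Definition scalar_frenet (c0 : R) (x y z : R -> R) : Prop :=
  forall s, is_derive x s (c0 * y s) /\
    is_derive y s (c0 * x s + s / 2 * z s) /\ is_derive z s (- (s / 2 * y s)).

Lemma frenet_coordinate (c0 : R) (T n b : R -> R3) (A : R3 -> R)
  (HA : is_linear (V := R_NormedModule) A) :
  frenet_system c0 T n b ->
  scalar_frenet c0 (fun s => A (T s)) (fun s => A (n s)) (fun s => A (b s)).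
Proof.
  intros H s. destruct (H s) as (H1 & H2 & H3).
  pose proof (is_derive_linear A HA _ _ _ H1) as D1.
  pose proof (is_derive_linear A HA _ _ _ H2) as D2.
  pose proof (is_derive_linear A HA _ _ _ H3) as D3.
  rewrite (linear_scal A HA) in D1.
  rewrite (linear_plus A HA), !(linear_scal A HA) in D2.
  rewrite (linear_opp A _ HA), (linear_scal A HA) in D3.
  auto.
Qed.

Lemma scalar_frenet_norm c0 x y z s : scalar_frenet c0 x y z -> 0 <= s ->
  - x s ^ 2 + y s ^ 2 + z s ^ 2 = - x 0 ^ 2 + y 0 ^ 2 + z 0 ^ 2.
Proof.
  intros H [Hs|<-]; [|reflexivity]. symmetry.
  apply (eq_is_derive (fun s => - x s ^ 2 + y s ^ 2 + z s ^ 2)); [|exact Hs].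
  intros t _. destruct (H t) as (H1 & H2 & H3).
  auto_derive.
  - repeat split; eexists; eassumption.
  - change (Derive (fun s => x s) t) with (Derive x t).
    change (Derive (fun s => y s) t) with (Derive y t).
    change (Derive (fun s => z s) t) with (Derive z t).
    rewrite (is_derive_unique _ _ _ H1), (is_derive_unique _ _ _ H2), (is_derive_unique _ _ _ H3).
    change (zero : R) with 0. field.
Qed.

(** [c0 sol_W] is the complex combination [n + i b] of the solution of the scalar
    system whose first component is [|J|^2 + al |I|^2]. *)
Definition sol_W (al s : R) : C := (Cconj (sol_J al s) * sol_I al s)%C.

(** The polarised form [- x X + y Y + z Z] of two solutions is constant, because
    the form itself is. *)
Lemma scalar_frenet_invariant c0 x y z s : scalar_frenet c0 x y z -> 0 <= s ->
  let al := c0 ^ 2 / 4 in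
  let Q := fun s => - x s * (Cmod (sol_J al s) ^ 2 + al * Cmod (sol_I al s) ^ 2)
    + c0 * (y s * Re (sol_W al s) + z s * Im (sol_W al s)) in
  Q s = Q 0.
Proof.
  intros H Hs al Q. destruct Hs as [Hs|<-]; [|reflexivity]. symmetry.
  apply (eq_is_derive Q); [|exact Hs].
  intros t _. destruct (H t) as (H1 & H2 & H3).
  pose proof (is_derive_sol_I al t) as DI. pose proof (is_derive_sol_J al t) as DJ.
  pose proof (is_derive_Cmod_sqr _ _ _ DI) as NI. pose proof (is_derive_Cmod_sqr _ _ _ DJ) as NJ.
  pose proof (is_derive_C_mult _ _ _ _ _
    (is_derive_linear (V := C_R_NormedModule) Cconj is_linear_Cconj _ _ _ DJ) DI) as DW.
  pose proof (is_derive_Re _ _ _ DW) as W1. pose proof (is_derive_Im _ _ _ DW) as W2.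
  change (fun s => Re (Cconj (sol_J al s) * sol_I al s)) with (fun s => Re (sol_W al s)) in W1.
  change (fun s => Im (Cconj (sol_J al s) * sol_I al s)) with (fun s => Im (sol_W al s)) in W2.
  set (nJ := fun s => Cmod (sol_J al s) ^ 2) in *.
  set (nI := fun s => Cmod (sol_I al s) ^ 2) in *.
  set (w1 := fun s => Re (sol_W al s)) in *.
  set (w2 := fun s => Im (sol_W al s)) in *.
  apply is_derive_ext with (f := fun s => - x s * (nJ s + al * nI s)
    + c0 * (y s * w1 s + z s * w2 s)); [reflexivity|].
  auto_derive.
  - repeat split; eexists; eassumption.
  - change (Derive (fun s => x s) t) with (Derive x t).
    change (Derive (fun s => y s) t) with (Derive y t).
    change (Derive (fun s => z s) t) with (Derive z t).
    change (Derive (fun s => nJ s) t) with (Derive nJ t).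
    change (Derive (fun s => nI s) t) with (Derive nI t).
    change (Derive (fun s => w1 s) t) with (Derive w1 t).
    change (Derive (fun s => w2 s) t) with (Derive w2 t).
    rewrite (is_derive_unique x _ _ H1), (is_derive_unique y _ _ H2), (is_derive_unique z _ _ H3),
      (is_derive_unique nJ _ _ NJ), (is_derive_unique nI _ _ NI),
      (is_derive_unique w1 _ _ W1), (is_derive_unique w2 _ _ W2).
    unfold nJ, nI, w1, w2. rewrite !Cmod_sqr. unfold sol_W.
    destruct (sol_I al t) as [i1 i2], (sol_J al t) as [j1 j2].
    change (zero : R) with 0. unfold Re, Im. simpl. unfold al. field.
Qed.

Lemma Rabs_le_of_sqr (u v : R) : 0 <= v -> u ^ 2 <= v ^ 2 -> Rabs u <= v.
Proof. intros Hv H. unfold Rabs. destruct Rcase_abs; nra. Qed.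

Lemma gamma_sq_1_value al : 0 < al -> gamma_sq 1 al = PI * al / sinh (PI * al) /\ 0 < sinh (PI * al).
Proof.
  intros Ha. pose proof (gamma_sq_1_reflection al) as H. pose proof PI_RGT_0.
  assert (Hs : 0 < sinh (PI * al)).
  { rewrite <- sinh_0. apply sinh_lt. nra. }
  split; [|exact Hs]. apply Rmult_eq_reg_r with (sinh (PI * al)); [|lra].
  rewrite H. field. lra.
Qed.

(** The invariant reads [- x (|J|^2 + al |I|^2) + Er = Q0], where
    [|Er| <= (1 + |x|) c0 |J| |I|] by Cauchy-Schwarz and [y^2 + z^2 = 1 + x^2].
    As [|J| |I|] tends to 0, this first bounds [x] for large [s], then shows that
    [Er] tends to 0. *)
Lemma scalar_frenet_limit c0 x y z : 0 < c0 -> scalar_frenet c0 x y z ->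
  x 0 = 0 -> y 0 ^ 2 + z 0 ^ 2 = 1 ->
  let al := c0 ^ 2 / 4 in
  is_lim x p_infty
    (- (c0 * (y 0 * Re (sol_W al 0) + z 0 * Im (sol_W al 0)))
     / (exp (- (PI * al)) * gamma_sq 1 (2 * al) / 4)).
Proof.
  intros Hc H Hx0 Hyz al.
  set (D := exp (- (PI * al)) * gamma_sq 1 (2 * al) / 4).
  set (Q0 := c0 * (y 0 * Re (sol_W al 0) + z 0 * Im (sol_W al 0))).
  assert (Hal : 0 < al) by (unfold al; nra).
  assert (HD : 0 < D).
  { destruct (gamma_sq_1_value (2 * al)) as [E Hs]; [lra|]. unfold D. rewrite E.
    pose proof (exp_pos (- (PI * al))). pose proof PI_RGT_0.
    assert (0 < PI * (2 * al) / sinh (PI * (2 * al))) by (apply Rdiv_lt_0_compat; nra).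
    nra. }
  set (That := fun s => Cmod (sol_J al s) ^ 2 + al * Cmod (sol_I al s) ^ 2).
  set (Er := fun s => c0 * (y s * Re (sol_W al s) + z s * Im (sol_W al s))).
  set (eps := fun s => c0 * Cmod (sol_W al s)).
  assert (HQ : forall s, 0 <= s -> - x s * That s + Er s = Q0).
  { intros s Hs. pose proof (scalar_frenet_invariant c0 x y z s H Hs) as HI. cbv zeta in HI.
    fold al in HI. unfold That, Er. rewrite HI, Hx0. unfold Q0. ring. }
  assert (HE : forall s, 0 <= s -> Rabs (Er s) <= (1 + Rabs (x s)) * eps s).
  { intros s Hs. pose proof (scalar_frenet_norm c0 x y z s H Hs) as HN.
    unfold Er, eps. pose proof (Cmod_ge_0 (sol_W al s)). pose proof (Rabs_pos (x s)).
    apply Rabs_le_of_sqr; [apply Rmult_le_pos; nra|].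
    rewrite !Rpow_mult_distr, Cmod_sqr.
    set (w1 := Re (sol_W al s)). set (w2 := Im (sol_W al s)).
    assert (K1 : (y s * w1 + z s * w2) ^ 2 <= (y s ^ 2 + z s ^ 2) * (w1 ^ 2 + w2 ^ 2)).
    { pose proof (pow2_ge_0 (y s * w2 - z s * w1)). nra. }
    assert (K2 : y s ^ 2 + z s ^ 2 <= (1 + Rabs (x s)) ^ 2).
    { rewrite Hx0 in HN. rewrite <- (pow2_abs (x s)) in HN. nra. }
    assert (K3 : 0 <= w1 ^ 2 + w2 ^ 2) by (pose proof (pow2_ge_0 w1); pose proof (pow2_ge_0 w2); lra).
    pose proof (pow2_ge_0 c0).
    apply Rle_trans with (c0 ^ 2 * ((1 + Rabs (x s)) ^ 2 * (w1 ^ 2 + w2 ^ 2))); [|apply Req_le; ring].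
    apply Rmult_le_compat_l; [assumption|]. eapply Rle_trans; [exact K1|].
    apply Rmult_le_compat_r; assumption. }
  assert (LJ : is_lim (fun s => Cmod (sol_J al s) ^ 2) p_infty D) by apply is_lim_sol_J.
  assert (LI : is_lim (fun s => Cmod (sol_I al s)) p_infty 0) by apply is_lim_sol_I.
  assert (LI2 : is_lim (fun s => Cmod (sol_I al s) ^ 2) p_infty 0).
  { replace (Finite 0) with (Finite (0 ^ 2)) by (f_equal; ring).
    apply (is_lim_comp_continuous (fun s => Cmod (sol_I al s)) (fun x => x ^ 2) p_infty 0 LI).
    apply (ex_derive_continuous (fun x => x ^ 2)). auto_derive; trivial. }
  assert (LT : is_lim That p_infty D).
  { eapply is_lim_plus; [exact LJ|apply is_lim_scal_l, LI2|].
    unfold is_Rbar_plus; simpl. f_equal. f_equal. ring. }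
  assert (Leps : is_lim eps p_infty 0).
  { apply is_lim_ext with (fun s => c0 * (sqrt (Cmod (sol_J al s) ^ 2) * Cmod (sol_I al s))).
    { intros s. unfold eps, sol_W. rewrite Cmod_mult, Cmod_conj, sqrt_pow2; [reflexivity|].
      apply Cmod_ge_0. }
    replace (Finite 0) with (Rbar_mult c0 (Rbar_mult (sqrt D) 0)) by (simpl; f_equal; ring).
    apply is_lim_scal_l. apply is_lim_mult; [|exact LI|exact I].
    apply (is_lim_comp_continuous _ sqrt p_infty D LJ), continuous_sqrt. }
  (* For large s, That exceeds 3D/4 and |Er| is at most 1 + (D/4) |x|; hence the
     bound X. *)
  set (X := (Rabs Q0 + 1) * 2 / D).
  assert (Hev : Rbar_locally' p_infty (fun s => Rabs (x s) <= X /\ 0 < That s)).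
  { assert (Hd : 0 < Rmin 1 (D / 4)) by (apply Rmin_pos; lra).
    apply is_lim_spec in LT. specialize (LT (mkposreal _ Hd)).
    apply is_lim_spec in Leps. specialize (Leps (mkposreal _ Hd)).
    destruct LT as [M1 HM1]. destruct Leps as [M2 HM2].
    exists (Rmax 0 (Rmax M1 M2)). intros s Hs.
    pose proof (Rmax_l 0 (Rmax M1 M2)). pose proof (Rmax_r 0 (Rmax M1 M2)).
    pose proof (Rmax_l M1 M2). pose proof (Rmax_r M1 M2).
    assert (K1 : Rabs (That s - D) < Rmin 1 (D / 4)) by (apply HM1; lra).
    assert (K2 : Rabs (eps s - 0) < Rmin 1 (D / 4)) by (apply HM2; lra).
    pose proof (Rmin_l 1 (D / 4)). pose proof (Rmin_r 1 (D / 4)).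
    apply Rabs_lt_between in K1. apply Rabs_lt_between in K2.
    assert (Hs0 : 0 <= s) by lra.
    split; [|lra]. specialize (HQ s Hs0). specialize (HE s Hs0).
    assert (HxT : Rabs (x s) * That s <= Rabs Q0 + Rabs (Er s)).
    { rewrite <- (Rabs_pos_eq (That s)) by lra. rewrite <- Rabs_mult.
      replace (x s * That s) with (Er s - Q0) by lra.
      eapply Rle_trans; [apply Rabs_triang|]. rewrite Rabs_Ropp. lra. }
    pose proof (Rabs_pos (x s)). pose proof (Rabs_pos Q0).
    assert (Rabs (x s) * (D / 2) <= Rabs Q0 + 1) by nra.
    unfold X. apply Rmult_le_reg_r with (D / 2); [lra|].
    eapply Rle_trans; [eassumption|]. apply Req_le. field. lra. }
  assert (LE : is_lim Er p_infty 0).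
  { assert (HL : forall c, is_lim (fun s => c * (1 + X) * eps s) p_infty 0).
    { intros c. replace (Finite 0) with (Rbar_mult (c * (1 + X)) 0) by (simpl; f_equal; ring).
      apply is_lim_scal_l, Leps. }
    apply is_lim_le_le_loc with (fun s => - 1 * (1 + X) * eps s) (fun s => 1 * (1 + X) * eps s);
      [|apply HL|apply HL].
    destruct Hev as [M HM]. exists (Rmax 0 M). intros s Hs.
    pose proof (Rmax_l 0 M). pose proof (Rmax_r 0 M).
    destruct (HM s) as [HX _]; [lra|]. assert (Hs0 : 0 <= s) by lra.
    specialize (HE s Hs0). assert (0 <= eps s).
    { unfold eps. apply Rmult_le_pos; [lra|apply Cmod_ge_0]. }
    assert (Hb : Rabs (Er s) <= (1 + X) * eps s) by nra.
    apply Rabs_le_between in Hb. lra. }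
  apply is_lim_ext_loc with (fun s => (Er s - Q0) / That s).
  { destruct Hev as [M HM]. exists (Rmax 0 M). intros s Hs.
    pose proof (Rmax_l 0 M). pose proof (Rmax_r 0 M).
    destruct (HM s) as [_ HT]; [lra|]. assert (Hs0 : 0 <= s) by lra.
    specialize (HQ s Hs0). apply Rmult_eq_reg_r with (That s); [|lra].
    unfold Rdiv. rewrite Rmult_assoc, Rinv_l; lra. }
  replace (Finite (- Q0 / D)) with (Rbar_div (- Q0) D).
  2:{ reflexivity. }
  apply is_lim_div; [|exact LT|intros HD0; injection HD0; lra|exact I].
  eapply is_lim_minus; [exact LE|apply is_lim_const|].
  unfold is_Rbar_minus, is_Rbar_plus; simpl. f_equal. f_equal. ring.
Qed.

(** * The limit of the tangent vector *)
Lemma Cexp_quarter_turn : Cexp (Ci * RtoC (PI / 4)) = Cconj wbar.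
Proof.
  unfold Cexp, wbar, Cconj; simpl.
  replace (0 * (PI / 4) - 1 * 0) with 0 by ring.
  replace (0 * 0 + 1 * (PI / 4)) with (PI / 4) by ring.
  rewrite exp_0, cos_PI4, sin_PI4. apply injective_projections; simpl; field;
    apply Rgt_not_eq, sqrt_lt_R0; lra.
Qed.

Lemma Upsilon_sol_W c0 : Upsilon c0 = (- (4 * sol_W (c0 ^ 2 / 4) 0))%C.
Proof.
  set (al := c0 ^ 2 / 4). unfold Upsilon. fold al.
  replace (1 - Ci * RtoC al)%C with (Cconj (1, al))
    by (apply injective_projections; simpl; ring).
  replace (RtoC (1 / 2) + Ci * RtoC al)%C with ((/ 2)%R, al)
    by (apply injective_projections; simpl; field).
  rewrite CGamma_conj by (simpl; lra).
  rewrite Cexp_quarter_turn, <- Cmult_conj, sol_J_0, sol_I_0. unfold sol_W.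
  destruct (sol_J al 0), (sol_I al 0). apply injective_projections; simpl; ring.
Qed.

Lemma CGamma_three_halves : CGamma (RtoC (3 / 2)) = RtoC (sqrt PI / 2).
Proof.
  replace (RtoC (3 / 2)) with (RtoC (/ 2) + 1)%C
    by (apply injective_projections; simpl; field).
  rewrite CGamma_succ by (simpl; lra). rewrite CGamma_half.
  apply injective_projections; simpl; field.
Qed.

Theorem mainTheorem2 (c0 : R) (hc0 : 0 < c0) (T n b : R -> R3)
  (hsys : frenet_system c0 T n b)
  (hT0 : T 0 = vec3 1 0 0) (hn0 : n 0 = vec3 0 1 0) (hb0 : b 0 = vec3 0 0 1) :
  is_lim (fun s => coord2 (T s)) p_infty
    (Finite (2 / (PI * c0) * exp (PI * c0 ^ 2 / 4) * sinh (PI * c0 ^ 2 / 2)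
             * Re (Upsilon c0))) /\
  is_lim (fun s => coord3 (T s)) p_infty
    (Finite (2 / (PI * c0) * exp (PI * c0 ^ 2 / 4) * sinh (PI * c0 ^ 2 / 2)
             * Im (Upsilon c0))) /\
  Upsilon c0 =
    (RtoC (sqrt PI / 2) * Cexp (Ci * RtoC (PI / 4)) *
     CBeta (1 - Ci * RtoC (c0 ^ 2 / 4))
           (RtoC (1 / 2) + Ci * RtoC (c0 ^ 2 / 4)))%C.
Proof.
  pose proof PI_RGT_0 as HPI.
  assert (HK : forall w, - (c0 * w) /
      (exp (- (PI * (c0 ^ 2 / 4))) * gamma_sq 1 (2 * (c0 ^ 2 / 4)) / 4)
    = 2 / (PI * c0) * exp (PI * c0 ^ 2 / 4) * sinh (PI * c0 ^ 2 / 2) * (- (4 * w))).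
  { intros w. destruct (gamma_sq_1_value (2 * (c0 ^ 2 / 4))) as [E Hs]; [nra|].
    rewrite E. replace (PI * c0 ^ 2 / 4) with (PI * (c0 ^ 2 / 4)) by field.
    replace (PI * c0 ^ 2 / 2) with (PI * (2 * (c0 ^ 2 / 4))) by field.
    rewrite exp_Ropp. set (S := sinh _) in *. pose proof (exp_pos (PI * (c0 ^ 2 / 4))).
    set (X := exp _) in *. field. repeat split; lra. }
  split; [|split].
  - pose proof (frenet_coordinate c0 T n b coord2
      (is_linear_comp fst snd is_linear_fst is_linear_snd) hsys) as H.
    pose proof (scalar_frenet_limit c0 _ _ _ hc0 H) as HL. cbv beta zeta in HL.
    rewrite hT0, hn0, hb0 in HL.
    change (coord2 (vec3 1 0 0)) with 0 in HL. change (coord2 (vec3 0 1 0)) with 1 in HL.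
    change (coord2 (vec3 0 0 1)) with 0 in HL.
    rewrite Rmult_1_l, Rmult_0_l, Rplus_0_r, HK in HL.
    rewrite Upsilon_sol_W.
    replace (Re (- (4 * sol_W (c0 ^ 2 / 4) 0))) with (- (4 * Re (sol_W (c0 ^ 2 / 4) 0)))
      by (simpl; unfold Re; ring).
    apply HL; ring.
  - pose proof (frenet_coordinate c0 T n b coord3 is_linear_snd hsys) as H.
    pose proof (scalar_frenet_limit c0 _ _ _ hc0 H) as HL. cbv beta zeta in HL.
    rewrite hT0, hn0, hb0 in HL.
    change (coord3 (vec3 1 0 0)) with 0 in HL. change (coord3 (vec3 0 1 0)) with 0 in HL.
    change (coord3 (vec3 0 0 1)) with 1 in HL.
    rewrite Rmult_1_l, Rmult_0_l, Rplus_0_l, HK in HL.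
    rewrite Upsilon_sol_W.
    replace (Im (- (4 * sol_W (c0 ^ 2 / 4) 0))) with (- (4 * Im (sol_W (c0 ^ 2 / 4) 0)))
      by (simpl; unfold Im; ring).
    apply HL; ring.
  - unfold CBeta, Upsilon.
    replace (1 - Ci * RtoC (c0 ^ 2 / 4) + (RtoC (1 / 2) + Ci * RtoC (c0 ^ 2 / 4)))%C
      with (RtoC (3 / 2)) by (apply injective_projections; simpl; field).
    rewrite CGamma_three_halves. field.
    intros E. apply RtoC_inj in E. pose proof (sqrt_lt_R0 PI HPI). lra.
Qed.
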